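(* Let $k,l\ge3$ be integers and let $X=(x_{i,j})$ be a $3\times kl$ matrix. Let $R_i=\{i,k+i,\ldots,(l-1)k+i\}$ ($i\in[k]$), $C_j=\{(j-1)k+1,\ldots,(j-1)k+k\}$ ($j\in[l]$), $R=\{R_1,\ldots,R_k\}$, $C=\{C_1,\ldots,C_l\}$, $\Delta=\bigcup_{i\in[k]}\binom{R_i}{3}\cup\bigcup_{j\in[l]}\binom{C_j}{3}$, and $V_\Delta=\{Y\in\mathbb{C}^{3\times kl}:\operatorname{rank}(Y_F)<|F|\text{ for all }F\in\Delta\}$, where $Y_F$ is the submatrix with columns indexed by $F$. Then $V_\Delta$ has the irredundant irreducible decomposition $$V_\Delta=\bigcup_{\mathcal{Q}}V_{G_{k,l}(\mathcal{Q})},$$ where the union ranges over all partitions $\mathcal{Q}=\{Q_1,\ldots,Q_m\}$ of $R\cup C$ such that for each $i\in[m]$ with $|Q_i|\ge2$: (i) $|Q_i\cap R|\ge3$, $|Q_i\cap C|\ge3$ and $\max\{|Q_i\cap R|,|Q_i\cap C|\}\ge4$; (ii) if $|\mathcal{Q}|>1$, then neither $R\subseteq Q_i$ nor $C\subseteq Q_i$.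
   Context: For a partition $\mathcal{Q}=\{Q_1,\ldots,Q_m\}$ of $R\cup C$, let $H_i=\bigcup_{L\in Q_i}L\subseteq[kl]$, and let $G_{k,l}(\mathcal{Q})$ be the matroid on $[kl]$ whose circuits are: (Type 1) the 2-element subsets contained in $H_i\cap H_j$ for some $i\ne j$; (Type 2) the 3-element subsets of some $H_i$ containing no Type 1 set; (Type 3) the 4-element subsets containing no Type 1 or Type 2 set. For a matroid $N$ on $[kl]$, a realization is a $3\times kl$ complex matrix whose columns indexed by $S$ are linearly dependent iff $S$ is dependent in $N$; the matroid variety $V_N\subseteq\mathbb{C}^{3\times kl}$ is the Zariski closure of the set of realizations. Irredundant means each $V_{G_{k,l}(\mathcal{Q})}$ is irreducible and none is contained in another. *)

(* Defs.v *)
From HB Require Import structures.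
From mathcomp Require Import all_boot all_order all_algebra.
From mathcomp Require Import Rstruct.
From mathcomp.real_closed Require Import complex.
From mathcomp Require mpoly.

Set Implicit Arguments.
Unset Strict Implicit.
Unset Printing Implicit Defensive.
Import GRing.Theory.
Local Open Scope ring_scope.

Notation CC := (Rdefinitions.R)[i].

Definition mset (m n : nat) := 'M[CC]_(m, n) -> Prop.

Definition mx_eval (m n : nat) (p : mpoly.mpoly (m * n) CC) (Y : 'M[CC]_(m, n)) : CC :=
  mpoly.meval (fun i => mxvec Y 0 i) p.

Definition zclosed (m n : nat) (V : mset m n) : Prop :=
  exists P : mpoly.mpoly (m * n) CC -> Prop,
    forall Y, V Y <-> (forall p, P p -> mx_eval p Y = 0).

Definition zclosure (m n : nat) (S : mset m n) : mset m n :=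
  fun Y => forall Z : mset m n, zclosed Z -> (forall X, S X -> Z X) -> Z Y.

Definition zirreducible (m n : nat) (V : mset m n) : Prop :=
  [/\ zclosed V, exists Y, V Y &
      forall A B : mset m n, zclosed A -> zclosed B ->
        (forall Y, V Y -> A Y \/ B Y) ->
        (forall Y, V Y -> A Y) \/ (forall Y, V Y -> B Y)].

Definition cols_dependent (m n : nat) (Y : 'M[CC]_(m, n)) (S : {set 'I_n}) : Prop :=
  exists c : 'I_n -> CC,
    [/\ exists2 j, j \in S & c j != 0,
        forall j, j \notin S -> c j = 0 &
        \sum_(j < n) c j *: col j Y = 0].

Definition colsubset (m n : nat) (Y : 'M[CC]_(m, n)) (F : {set 'I_n}) : 'M[CC]_(m, #|F|) :=
  colsub (fun j : 'I_#|F| => enum_val j) Y.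

(* The k x l grid. Ground set [kl] is 'I_(k*l), 0-indexed: element x  *)
(* corresponds to x+1 in the paper.                                   *)
(* Lines: inl i = R_{i+1} = {x | x mod k = i},                        *)
(*        inr j = C_{j+1} = {x | x div k = j}.                        *)
Definition line (k l : nat) := ('I_k + 'I_l)%type.

Definition line_set (k l : nat) (L : line k l) : {set 'I_(k * l)} :=
  match L with
  | inl i => [set x : 'I_(k * l) | (x %% k)%N == i]
  | inr j => [set x : 'I_(k * l) | (x %/ k)%N == j]
  end.

Definition Rlines (k l : nat) : {set line k l} := [set L : line k l | if L is inl _ then true else false].
Definition Clines (k l : nat) : {set line k l} := [set L : line k l | if L is inr _ then true else false].

Definition VDelta (k l : nat) : mset 3 (k * l) :=
  fun Y => forall F : {set 'I_(k * l)}, #|F| = 3%N ->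
    (exists L : line k l, F \subset line_set L) ->
    (\rank (colsubset Y F) < #|F|)%N.

Definition admissible (k l : nat) (Q : {set {set line k l}}) : Prop :=
  partition Q [set: line k l] /\
  forall B, B \in Q -> (1 < #|B|)%N ->
    [/\ (3 <= #|B :&: Rlines k l|)%N, (3 <= #|B :&: Clines k l|)%N,
        (4 <= maxn #|B :&: Rlines k l| #|B :&: Clines k l|)%N &
        ((1 < #|Q|)%N -> ~~ (Rlines k l \subset B) /\ ~~ (Clines k l \subset B))].

Definition Hset (k l : nat) (B : {set line k l}) : {set 'I_(k * l)} :=
  \bigcup_(L in B) line_set L.

Definition circ1 (k l : nat) (Q : {set {set line k l}}) (S : {set 'I_(k * l)}) : Prop :=
  #|S| = 2%N /\ exists B1 B2, [/\ B1 \in Q, B2 \in Q, B1 != B2 &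
                                 S \subset Hset B1 :&: Hset B2].

Definition circ2 (k l : nat) (Q : {set {set line k l}}) (S : {set 'I_(k * l)}) : Prop :=
  [/\ #|S| = 3%N, (exists2 B, B \in Q & S \subset Hset B) &
      forall T : {set 'I_(k * l)}, T \subset S -> ~ circ1 Q T].

Definition circ3 (k l : nat) (Q : {set {set line k l}}) (S : {set 'I_(k * l)}) : Prop :=
  [/\ #|S| = 4%N, forall T : {set 'I_(k * l)}, T \subset S -> ~ circ1 Q T &
      forall T : {set 'I_(k * l)}, T \subset S -> ~ circ2 Q T].

Definition Gcircuit (k l : nat) (Q : {set {set line k l}}) (S : {set 'I_(k * l)}) : Prop :=
  [\/ circ1 Q S, circ2 Q S | circ3 Q S].

Definition Gdependent (k l : nat) (Q : {set {set line k l}}) (S : {set 'I_(k * l)}) : Prop :=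
  exists2 T : {set 'I_(k * l)}, T \subset S & Gcircuit Q T.

Definition realization (k l : nat) (Q : {set {set line k l}}) : mset 3 (k * l) :=
  fun Y => forall S : {set 'I_(k * l)}, cols_dependent Y S <-> Gdependent Q S.

Definition VG (k l : nat) (Q : {set {set line k l}}) : mset 3 (k * l) :=
  zclosure (realization Q).

Arguments VDelta : clear implicits.

(* Main.v *)
Require Import Defs.
From mathcomp Require Import all_boot all_order all_algebra.
From mathcomp Require Import Rstruct ring.
From mathcomp.real_closed Require Import complex.
From mathcomp Require Import -(notations) mpoly.
From Stdlib Require Import Classical FunctionalExtensionality.

(** Choose for every row and column a nonzero covector killing its points, and
    group the lines whose covectors are proportional: V_Delta is the union, over
    all partitions Q, of the images of polynomial maps Phi_Q.  For admissible Q
    the image of Phi_Q contains the realizations as a nonempty Zariski open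
    subset (any independent set of at most three points is made independent by
    placing the covectors at the standard basis), so V_G(Q) is its closure and
    is irreducible.

    If a block has at most two rows, or at most two columns, or is 3 x 3, its
    common covector l can be perturbed to l + t v_L so that, for generic
    configurations, the points of the block are limits of intersections of the
    perturbed lines; hence such a block may be split into singletons.  If a block
    contains all rows or all columns, every point lies on its line and the
    partition may be replaced by the trivial one.  This leaves only admissible
    partitions.

    For irredundancy, inclusion of V_G(Q) in V_G(Q') forces Q' to refine Q, any
    block of Q that is properly refined being cut into singletons.  Such a block
    contains a 3 x 4 grid, and one polynomial separates the two: the twelve
    conditions that p_(r,c) be parallel to v_r - v_c determine v_2 - v_1 up to
    scale from three columns, and using two different triples of columns gives a
    relation satisfied by grids of intersection points but not by arbitrary
    points of one line. *)

Set Implicit Arguments.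
Unset Strict Implicit.
Unset Printing Implicit Defensive.
Import GRing.Theory.
Local Open Scope ring_scope.

(** * Cross products and the two-row elimination *)

Lemma div_neq0 (F : fieldType) (x y : F) : x != 0 -> y != 0 -> x / y != 0.
Proof. by move=> x0 y0; rewrite mulf_neq0 ?invr_eq0. Qed.

Lemma mul_neq0 (F : fieldType) (x y : F) : x * y != 0 -> x != 0 /\ y != 0.
Proof. by rewrite mulf_eq0 negb_or => /andP. Qed.

Lemma scaler_divK (F : fieldType) (V : lmodType F) (x y : F) (u : V) :
  y != 0 -> (x / y) *: (y *: u) = x *: u.
Proof. by move=> y0; rewrite scalerA divfK. Qed.

Section Vectors.
Variable F : fieldType.
Implicit Types (k : F) (a b c d u v w l m p z : 'cV[F]_3).

Definition vec3 (a b c : F) : 'cV[F]_3 := \col_i [:: a; b; c]`_i.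
Definition x0 u := u (@Ordinal 3 0 isT) 0.
Definition x1 u := u (@Ordinal 3 1 isT) 0.
Definition x2 u := u (@Ordinal 3 2 isT) 0.

Lemma x0_vec3 (a b c : F) : x0 (vec3 a b c) = a. Proof. by rewrite /x0 mxE. Qed.
Lemma x1_vec3 (a b c : F) : x1 (vec3 a b c) = b. Proof. by rewrite /x1 mxE. Qed.
Lemma x2_vec3 (a b c : F) : x2 (vec3 a b c) = c. Proof. by rewrite /x2 mxE. Qed.
Lemma x0D u v : x0 (u + v) = x0 u + x0 v. Proof. by rewrite /x0 mxE. Qed.
Lemma x1D u v : x1 (u + v) = x1 u + x1 v. Proof. by rewrite /x1 mxE. Qed.
Lemma x2D u v : x2 (u + v) = x2 u + x2 v. Proof. by rewrite /x2 mxE. Qed.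
Lemma x0N u : x0 (- u) = - x0 u. Proof. by rewrite /x0 mxE. Qed.
Lemma x1N u : x1 (- u) = - x1 u. Proof. by rewrite /x1 mxE. Qed.
Lemma x2N u : x2 (- u) = - x2 u. Proof. by rewrite /x2 mxE. Qed.
Lemma x0Z k u : x0 (k *: u) = k * x0 u. Proof. by rewrite /x0 mxE. Qed.
Lemma x1Z k u : x1 (k *: u) = k * x1 u. Proof. by rewrite /x1 mxE. Qed.
Lemma x2Z k u : x2 (k *: u) = k * x2 u. Proof. by rewrite /x2 mxE. Qed.
Lemma x00 : x0 0 = 0. Proof. by rewrite /x0 mxE. Qed.
Lemma x10 : x1 0 = 0. Proof. by rewrite /x1 mxE. Qed.
Lemma x20 : x2 0 = 0. Proof. by rewrite /x2 mxE. Qed.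
Definition coordE := (x0_vec3, x1_vec3, x2_vec3, (x0D, x1D, x2D), (x0N, x1N, x2N),
                      (x0Z, x1Z, x2Z), (x00, x10, x20)).

Lemma col3P u v : x0 u = x0 v -> x1 u = x1 v -> x2 u = x2 v -> u = v.
Proof.
rewrite /x0 /x1 /x2 => h0 h1 h2; apply/colP => -[[|[|[|i]]] hi] //.
- by rewrite (_ : Ordinal hi = Ordinal (isT : 0 < 3)%N) //; apply: val_inj.
- by rewrite (_ : Ordinal hi = Ordinal (isT : 1 < 3)%N) //; apply: val_inj.
- by rewrite (_ : Ordinal hi = Ordinal (isT : 2 < 3)%N) //; apply: val_inj.
Qed.

Lemma col3_neq0 u : u != 0 -> [|| x0 u != 0, x1 u != 0 | x2 u != 0].
Proof.
apply: contraNT; rewrite !negb_or !negbK => /and3P[/eqP h0 /eqP h1 /eqP h2].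
by apply/eqP/col3P; rewrite coordE.
Qed.

Definition cross u v := vec3 (x1 u * x2 v - x2 u * x1 v)
  (x2 u * x0 v - x0 u * x2 v) (x0 u * x1 v - x1 u * x0 v).
Definition dot u v := x0 u * x0 v + x1 u * x1 v + x2 u * x2 v.
(** For fixed nonzero [l] this is an alternating form on vectors modulo [l]; its vanishing expresses
    that [a] and [b] are parallel modulo [l]. *)
Definition det3 l a b := dot l (cross a b).

Ltac vring := apply: col3P; rewrite /det3 /dot /cross ?coordE; ring.
Ltac sring := rewrite /det3 /dot /cross ?coordE; ring.

Lemma crossC u v : cross u v = - cross v u. Proof. vring. Qed.
Lemma crossuu u : cross u u = 0. Proof. vring. Qed.
Lemma crossNr u v : cross u (- v) = - cross u v. Proof. vring. Qed.
Lemma crossZr k u v : cross u (k *: v) = k *: cross u v. Proof. vring. Qed.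
Lemma crossZl k u v : cross (k *: u) v = k *: cross u v. Proof. vring. Qed.
Lemma cross0l u : cross 0 u = 0. Proof. vring. Qed.
Lemma dot_crossl u v : dot u (cross u v) = 0. Proof. sring. Qed.
Lemma dot_crossr u v : dot v (cross u v) = 0. Proof. sring. Qed.
Lemma dotC u v : dot u v = dot v u. Proof. sring. Qed.
Lemma dotZl k u v : dot (k *: u) v = k * dot u v. Proof. sring. Qed.
Lemma dotZr k u v : dot u (k *: v) = k * dot u v. Proof. sring. Qed.
Lemma dot0r u : dot u 0 = 0. Proof. sring. Qed.

Lemma cross_eq0 u v : v != 0 -> cross u v = 0 -> exists k, u = k *: v.
Proof.
move=> v0 h.
have h0 : x1 u * x2 v = x2 u * x1 v.
  by apply/eqP; rewrite -subr_eq0; have /(congr1 x0)/eqP := h; rewrite !coordE.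
have h1 : x2 u * x0 v = x0 u * x2 v.
  by apply/eqP; rewrite -subr_eq0; have /(congr1 x1)/eqP := h; rewrite !coordE.
have h2 : x0 u * x1 v = x1 u * x0 v.
  by apply/eqP; rewrite -subr_eq0; have /(congr1 x2)/eqP := h; rewrite !coordE.
case/or3P: (col3_neq0 v0) => hv.
- exists (x0 u / x0 v); apply: col3P; rewrite coordE ?divfK //.
    by rewrite mulrAC h2 mulfK.
  by rewrite mulrAC -h1 mulfK.
- exists (x1 u / x1 v); apply: col3P; rewrite coordE ?divfK //.
    by rewrite mulrAC -h2 mulfK.
  by rewrite mulrAC h0 mulfK.
- exists (x2 u / x2 v); apply: col3P; rewrite coordE ?divfK //.
    by rewrite mulrAC h1 mulfK.
  by rewrite mulrAC -h0 mulfK.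
Qed.

Lemma cross_trans u v w : v != 0 -> cross u v = 0 -> cross v w = 0 -> cross u w = 0.
Proof. by move=> v0 /(cross_eq0 v0)[c ->]; rewrite crossZl => ->; rewrite scaler0. Qed.

Lemma orth_cross2 l m p : cross l m != 0 -> dot l p = 0 -> dot m p = 0 ->
  exists k, p = k *: cross l m.
Proof.
move=> lm0 lp mp; apply: cross_eq0 => //.
have -> : cross p (cross l m) = (dot m p) *: l - (dot l p) *: m by vring.
by rewrite lp mp !scale0r subrr.
Qed.

Lemma orth_cross l p : l != 0 -> dot l p = 0 -> exists w, p = cross l w.
Proof.
move=> l0 lp; case/or3P: (col3_neq0 l0) => hl.
- exists (vec3 0 (x2 p / x0 l) (- (x1 p / x0 l))); apply: (scalerI hl).
  transitivity (x0 l *: p - dot l p *: vec3 1 0 0); first by rewrite lp scale0r subr0.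
  by apply: col3P; rewrite /cross /dot !coordE; field.
- exists (vec3 (- (x2 p / x1 l)) 0 (x0 p / x1 l)); apply: (scalerI hl).
  transitivity (x1 l *: p - dot l p *: vec3 0 1 0); first by rewrite lp scale0r subr0.
  by apply: col3P; rewrite /cross /dot !coordE; field.
- exists (vec3 (x1 p / x2 l) (- (x0 p / x2 l)) 0); apply: (scalerI hl).
  transitivity (x2 l *: p - dot l p *: vec3 0 0 1); first by rewrite lp scale0r subr0.
  by apply: col3P; rewrite /cross /dot !coordE; field.
Qed.

Lemma exists_orth p : exists2 l, l != 0 & dot l p = 0.
Proof.
case: (eqVneq (vec3 (- x1 p) (x0 p) 0) 0) => h; last first.
  by exists (vec3 (- x1 p) (x0 p) 0) => //; sring.
exists (vec3 0 1 0); last first.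
  have /(congr1 x0)/eqP := h; rewrite !coordE oppr_eq0 => /eqP p1.
  by rewrite /dot !coordE p1; ring.
by apply/eqP => /(congr1 x1) /eqP; rewrite !coordE oner_eq0.
Qed.

(** If two of the vectors are independent, their cross product works. Otherwise all are multiples of
    one nonzero [y i], or all vanish, and a covector killing that one suffices. *)
Lemma common_orth (I : finType) (P : pred I) (y : I -> 'cV[F]_3) :
  (forall i j h, P i -> P j -> P h -> det3 (y i) (y j) (y h) = 0) ->
  exists2 l, l != 0 & forall i, P i -> dot l (y i) = 0.
Proof.
move=> H; case: (pickP [pred ij : I * I | [&& P ij.1, P ij.2 & cross (y ij.1) (y ij.2) != 0]])
  => [[i j] /= /and3P[Pi Pj ij]|H2].
  by exists (cross (y i) (y j)) => // h Ph; rewrite dotC; apply: H.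
case: (pickP [pred i | P i && (y i != 0)]) => [i /= /andP[Pi yi]|H1].
  have [l l0 li] := exists_orth (y i); exists l => // j Pj.
  have /negbT := H2 (j, i); rewrite /= Pi Pj /= negbK => /eqP /(cross_eq0 yi)[c ->].
  by rewrite dotZr li mulr0.
have [l l0 _] := exists_orth 0; exists l => // i Pi.
by have /negbT := H1 i; rewrite /= Pi /= negbK => /eqP ->; rewrite dot0r.
Qed.

Lemma cross_pencil k l u v : cross (l + k *: u) (l + k *: v) =
  k *: (cross l (v - u) + k *: cross u v).
Proof. vring. Qed.
Lemma det3_0l a b : det3 0 a b = 0. Proof. sring. Qed.
Lemma det3D1 a b u v : det3 (a + b) u v = det3 a u v + det3 b u v. Proof. sring. Qed.
Lemma det3Z1 k a u v : det3 (k *: a) u v = k * det3 a u v. Proof. sring. Qed.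
(** The three-term Plücker relation in the plane modulo [l]; the elimination below rests on it. *)
Lemma det3_plucker l a b c d :
  det3 l a b * det3 l c d - det3 l a c * det3 l b d + det3 l a d * det3 l b c = 0.
Proof. sring. Qed.

Lemma det3_parallel l z p q u :
  det3 l z p = 0 -> det3 l z q = 0 -> det3 l z u != 0 -> det3 l p q = 0.
Proof.
move=> zp zq zu; have /eqP := det3_plucker l z u p q.
by rewrite zp zq !mul0r subr0 addr0 mulf_eq0 (negPf zu) => /eqP.
Qed.

(** The factor is read off by pairing [d] and [w] with [w'], which also certifies that [w] is
    nonzero modulo [l]. *)
Lemma cross_par l d w w' : det3 l d w = 0 -> det3 l w w' != 0 ->
  cross l d = (det3 l d w' / det3 l w w') *: cross l w.
Proof.
move=> dw ww; apply: (scalerI ww); rewrite scalerA mulrCA divff // mulr1.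
rewrite -[RHS]addr0 -(scale0r (- cross l w')) -dw; vring.
Qed.

Lemma cross_par_neq0 l d w w' : det3 l d w = 0 -> det3 l w w' != 0 -> det3 l d w' != 0 ->
  exists2 mu, mu != 0 & cross l d = mu *: cross l w.
Proof.
move=> dw ww dw'; exists (det3 l d w' / det3 l w w'); first exact: div_neq0.
exact: cross_par.
Qed.

Lemma det3C_neq0 l b c : det3 l b c != 0 -> det3 l c b != 0.
Proof. by rewrite (_ : det3 l b c = - det3 l c b) ?oppr_eq0 //; sring. Qed.

Lemma det3Bl l a b c : det3 l (a - b) c = det3 l a c - det3 l b c. Proof. sring. Qed.
Lemma det3Zl l k b c : det3 l (k *: b) c = k * det3 l b c. Proof. sring. Qed.
Lemma det3C l b c : det3 l b c = - det3 l c b. Proof. sring. Qed.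
Lemma det3uu l c : det3 l c c = 0. Proof. sring. Qed.
Lemma det3Dr l b c d : det3 l b (c + d) = det3 l b c + det3 l b d. Proof. sring. Qed.
Lemma det3Zr l k b c : det3 l b (k *: c) = k * det3 l b c. Proof. sring. Qed.


(** * Grids of parallelism conditions modulo a covector *)

Section TwoRows.
Variables (J : Type) (l : 'cV[F]_3) (w1 w2 w3 : J -> 'cV[F]_3).
Local Notation D j := (det3 l (w1 j) (w2 j)).

(* Coefficients of the linear condition on [z] for vectors v_1 = 0, v_2 = z, v_3 and v_j, v_h, v_i with v_q - v_p parallel to [w_p q] modulo [l]; the condition reads [det3 l z (zvec j h i) = 0]. *)
Definition kappa (j h i : J) :=
  det3 l (w1 j) (w3 j) * det3 l (w3 h) (w3 i) * (D h * D i).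

Definition zvec (j h i : J) : 'cV[F]_3 :=
  kappa j h i *: w2 j + kappa h i j *: w2 h + kappa i j h *: w2 i.

Lemma det3_zvec z j h i : det3 l z (zvec j h i) =
  kappa j h i * det3 l z (w2 j) + kappa h i j * det3 l z (w2 h)
    + kappa i j h * det3 l z (w2 i).
Proof. by rewrite /zvec !det3Dr !det3Zr. Qed.

(** The Plücker relation at column [q] eliminates [v q] and links [v3 - v1] to [v2 - v1] (the
    relation [e]). Substituting this into the Plücker relation of [v3 - v1] and three vectors [w3]
    leaves one linear condition on [v2 - v1]. *)
Lemma zvec_parallel (v1 v2 v3 : 'cV[F]_3) (v : J -> 'cV[F]_3) j h i :
  (forall q, det3 l (v q - v1) (w1 q) = 0) ->
  (forall q, det3 l (v q - v2) (w2 q) = 0) ->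
  (forall q, det3 l (v q - v3) (w3 q) = 0) ->
  det3 l (v2 - v1) (zvec j h i) = 0.
Proof.
move=> h1 h2 h3; rewrite det3_zvec.
have e q : D q * det3 l (v3 - v1) (w3 q) =
           det3 l (v2 - v1) (w2 q) * det3 l (w1 q) (w3 q).
  have := det3_plucker l (v q - v1) (w1 q) (w2 q) (w3 q).
  rewrite h1 mul0r sub0r addrC.
  have -> : det3 l (v q - v1) (w2 q) = det3 l (v2 - v1) (w2 q).
    by apply/eqP; rewrite -subr_eq0 -(h2 q); apply/eqP; sring.
  have -> : det3 l (v q - v1) (w3 q) = det3 l (v3 - v1) (w3 q).
    by apply/eqP; rewrite -subr_eq0 -(h3 q); apply/eqP; sring.
  by move/eqP; rewrite subr_eq0 mulrC => /eqP.
rewrite /kappa.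
transitivity ((det3 l (v3 - v1) (w3 j) * det3 l (w3 h) (w3 i)
   - det3 l (v3 - v1) (w3 h) * det3 l (w3 j) (w3 i)
   + det3 l (v3 - v1) (w3 i) * det3 l (w3 j) (w3 h)) * (D j * D h * D i)).
  rewrite (det3C l (w3 i) (w3 j)).
  transitivity ((det3 l (v2 - v1) (w2 j) * det3 l (w1 j) (w3 j)) * det3 l (w3 h) (w3 i) * (D h * D i)
    - (det3 l (v2 - v1) (w2 h) * det3 l (w1 h) (w3 h)) * det3 l (w3 j) (w3 i) * (D i * D j)
    + (det3 l (v2 - v1) (w2 i) * det3 l (w1 i) (w3 i)) * det3 l (w3 j) (w3 h) * (D j * D h)).
    by ring.
  by rewrite -(e j) -(e h) -(e i); ring.
by rewrite det3_plucker mul0r.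
Qed.

(** The solution for column [q] when the first two rows are at [0] and [z]: it is parallel to
    [w1 q], and its difference from [z] is parallel to [w2 q] modulo [l]. *)
Definition colvec z q : 'cV[F]_3 := (det3 l z (w2 q) / D q) *: w1 q.

Lemma cross_colvec_row2 z q : D q != 0 ->
  cross l (colvec z q - z) = (det3 l z (w1 q) / D q) *: cross l (w2 q).
Proof.
move=> D0; apply: (scalerI D0); rewrite scalerA mulrCA divff // mulr1.
rewrite /colvec -crossZr scalerBr scalerA mulrCA divff // mulr1; vring.
Qed.

(** Clearing denominators makes the nonvanishing of differences of columns a polynomial
    condition. *)
Lemma det3_colvec z (p q : J) u : D p != 0 -> D q != 0 ->
  D p * D q * det3 l (colvec z p - colvec z q) u =
  det3 l z (w2 p) * D q * det3 l (w1 p) u - det3 l z (w2 q) * D p * det3 l (w1 q) u.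
Proof. by move=> Dp Dq; rewrite det3Bl /colvec !det3Zl; field; apply/andP. Qed.

Variables (j h i : J).
Let z := zvec j h i.
Let y q := det3 l (colvec z q) (w3 q).
(** Cramer's rule for the third row: its pairings with [w3 j] and [w3 h] are to be [y j] and
    [y h]. *)
Definition row3vec : 'cV[F]_3 :=
  (det3 l (w3 j) (w3 h))^-1 *: (y h *: w3 j - y j *: w3 h).

Hypotheses (Dj : D j != 0) (Dh : D h != 0) (Di : D i != 0).
Hypothesis w30 : det3 l (w3 j) (w3 h) != 0.

(** Columns [j] and [h] hold by the choice of [row3vec]. Column [i] is then a compatibility
    condition on [z], namely that [z] be parallel to [zvec j h i], and [z] was chosen equal to
    it. *)
Lemma colvec_row3 : 
  [/\ det3 l (colvec z j - row3vec) (w3 j) = 0,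
      det3 l (colvec z h - row3vec) (w3 h) = 0 &
      det3 l (colvec z i - row3vec) (w3 i) = 0].
Proof.
have yE q : D q != 0 -> y q * D q = det3 l z (w2 q) * det3 l (w1 q) (w3 q).
  by move=> D0; rewrite /y /colvec det3Zl mulrAC divfK.
have rel : y j * det3 l (w3 h) (w3 i) + y h * det3 l (w3 i) (w3 j)
           + y i * det3 l (w3 j) (w3 h) = 0.
  apply: (mulIf Dj); apply: (mulIf Dh); apply: (mulIf Di).
  rewrite !mul0r -(det3uu l z) {2}/z det3_zvec /kappa.
  transitivity (y j * D j * det3 l (w3 h) (w3 i) * (D h * D i)
    + y h * D h * det3 l (w3 i) (w3 j) * (D i * D j)
    + y i * D i * det3 l (w3 j) (w3 h) * (D j * D h)); first by ring.
  by rewrite (yE j) // (yE h) // (yE i) //; ring.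
rewrite !det3Bl -!/(y _) /row3vec !det3Zl !det3Bl !det3Zl !det3uu.
split; apply: (mulIf w30); rewrite mul0r mulrBl [in X in _ - X]mulrAC mulVf // mul1r.
- by rewrite (det3C l (w3 h)); ring.
- by ring.
- rewrite -rel (det3C l (w3 i) (w3 j)); ring.
Qed.

(** Since [colvec z h - row3vec] is parallel to [w3 h], and likewise for [j], the third row may be
    replaced by a column in these pairings. They become the quantities of [det3_colvec]. *)
Lemma row3vec_neq :
  [/\ det3 l (colvec z j - row3vec) (w3 h) = det3 l (colvec z j - colvec z h) (w3 h),
      det3 l (colvec z h - row3vec) (w3 j) = det3 l (colvec z h - colvec z j) (w3 j) &
      det3 l (colvec z i - row3vec) (w3 j) = det3 l (colvec z i - colvec z j) (w3 j)].
Proof.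
have [h1 h2 h3] := colvec_row3.
split; rewrite -[LHS]subr0.
- by rewrite -h2; sring.
- by rewrite -h1; sring.
- by rewrite -h1; sring.
Qed.

End TwoRows.
End Vectors.

(** * Polynomial functions and Zariski closed sets *)

(** One closure notion serves polynomials in one variable, polynomial functions of the parameters
    and polynomials in matrix entries. [subalg_ext] permits rewriting up to pointwise equality. *)
Record subalgebra (X : Type) (P : (X -> CC) -> Prop) : Prop := Subalgebra {
  subalg_ext : forall f g, f =1 g -> P f -> P g;
  subalg_const : forall c, P (fun=> c);
  subalg_add : forall f g, P f -> P g -> P (fun x => f x + g x);
  subalg_mul : forall f g, P f -> P g -> P (fun x => f x * g x) }.

Section Subalgebra.
Variables (X : Type) (P : (X -> CC) -> Prop) (A : subalgebra P).

Lemma subalg_opp f : P f -> P (fun x => - f x).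
Proof.
move=> Pf; apply: (subalg_ext A (f := fun x => -1 * f x)) => [x|]; first by rewrite mulN1r.
by apply: subalg_mul => //; apply: subalg_const.
Qed.

Lemma subalg_sub f g : P f -> P g -> P (fun x => f x - g x).
Proof. by move=> Pf Pg; apply: subalg_add => //; apply: subalg_opp. Qed.

Lemma subalg_sum (I : Type) (r : seq I) (Q : pred I) (f : I -> X -> CC) :
  (forall i, P (f i)) -> P (fun x => \sum_(i <- r | Q i) f i x).
Proof.
move=> Pf; elim: r => [|i r IH].
  apply: (subalg_ext A (f := fun=> 0)); last exact: subalg_const.
  by move=> x; rewrite big_nil.
case Qi: (Q i).
  apply: (subalg_ext A (f := fun x => f i x + \sum_(i <- r | Q i) f i x)).
    by move=> x; rewrite big_cons Qi.
  exact: subalg_add.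
by apply: subalg_ext IH => // x; rewrite big_cons Qi.
Qed.

Lemma subalg_prod (I : Type) (r : seq I) (Q : pred I) (f : I -> X -> CC) :
  (forall i, P (f i)) -> P (fun x => \prod_(i <- r | Q i) f i x).
Proof.
move=> Pf; elim: r => [|i r IH].
  apply: (subalg_ext A (f := fun=> 1)); last exact: subalg_const.
  by move=> x; rewrite big_nil.
case Qi: (Q i).
  apply: (subalg_ext A (f := fun x => f i x * \prod_(i <- r | Q i) f i x)).
    by move=> x; rewrite big_cons Qi.
  exact: subalg_mul.
by apply: subalg_ext IH => // x; rewrite big_cons Qi.
Qed.

Lemma subalg_exp f n : P f -> P (fun x => f x ^+ n).
Proof.
move=> Pf; apply: (subalg_ext A (f := fun x => \prod_(i < n) f x)).
  by move=> x; rewrite prodr_const card_ord.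
exact: subalg_prod.
Qed.

Lemma subalg_det n (M : X -> 'M[CC]_n) :
  (forall i j, P (fun x => M x i j)) -> P (fun x => \det (M x)).
Proof.
move=> PM; apply: subalg_sum => s; apply: subalg_mul => //.
  exact: subalg_const.
exact: subalg_prod.
Qed.

Lemma subalg_mx_eval m n (p : mpoly.mpoly (m * n) CC) (Y : X -> 'M[CC]_(m, n)) :
  (forall i j, P (fun x => Y x i j)) -> P (fun x => mx_eval p (Y x)).
Proof.
move=> PY; apply: (subalg_ext A (f := fun x => \sum_(u <- mpoly.msupp p)
   mpoly.mcoeff u p * \prod_i (mxvec (Y x) 0 i) ^+ (mpoly.fun_of_multinom u i))).
  by move=> x; rewrite /mx_eval mpoly.mevalE.
apply: subalg_sum => u; apply: subalg_mul => //; first exact: subalg_const.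
apply: subalg_prod => i; apply: subalg_exp.
case/mxvec_indexP: i => i j; apply: subalg_ext (PY i j) => // x.
by rewrite mxvecE.
Qed.

Definition subalg_col (u : X -> 'cV[CC]_3) :=
  [/\ P (fun x => x0 (u x)), P (fun x => x1 (u x)) & P (fun x => x2 (u x))].

Lemma subalg_col_cst v : subalg_col (fun=> v).
Proof. by split; apply: subalg_const. Qed.

Lemma subalg_vec3 a b c : P a -> P b -> P c -> subalg_col (fun x => vec3 (a x) (b x) (c x)).
Proof.
by move=> Pa Pb Pc; split; [apply: subalg_ext Pa|apply: subalg_ext Pb|apply: subalg_ext Pc];
  move=> // x; rewrite coordE.
Qed.

Lemma subalg_colD u v : subalg_col u -> subalg_col v -> subalg_col (fun x => u x + v x).
Proof.
move=> [u0 u1 u2] [v0 v1 v2]; split;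
  [apply: subalg_ext (subalg_add A u0 v0) | apply: subalg_ext (subalg_add A u1 v1)
  | apply: subalg_ext (subalg_add A u2 v2)] => // x; by rewrite coordE.
Qed.

Lemma subalg_colZ f u : P f -> subalg_col u -> subalg_col (fun x => f x *: u x).
Proof.
move=> Pf [u0 u1 u2]; split;
  [apply: subalg_ext (subalg_mul A Pf u0) | apply: subalg_ext (subalg_mul A Pf u1)
  | apply: subalg_ext (subalg_mul A Pf u2)] => // x; by rewrite coordE.
Qed.

Lemma subalg_cross u v : subalg_col u -> subalg_col v -> subalg_col (fun x => cross (u x) (v x)).
Proof.
by move=> [u0 u1 u2] [v0 v1 v2]; apply: subalg_vec3; apply: subalg_sub; apply: subalg_mul.
Qed.

Lemma subalg_dot u v : subalg_col u -> subalg_col v -> P (fun x => dot (u x) (v x)).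
Proof.
move=> [u0 u1 u2] [v0 v1 v2].
by apply: subalg_add => //; [apply: subalg_add => //|]; apply: subalg_mul.
Qed.

Lemma subalg_det3 u v w : subalg_col u -> subalg_col v -> subalg_col w ->
  P (fun x => det3 (u x) (v x) (w x)).
Proof. by move=> Pu Pv Pw; apply: subalg_dot => //; apply: subalg_cross. Qed.

Lemma subalg_coord u i : subalg_col u -> P (fun x => u x i 0).
Proof.
have e (h : 'I_3) (d : 'I_3) : h = d -> P (fun x => u x d 0) -> P (fun x => u x h 0).
  by move=> ->.
move=> [u0 u1 u2]; case: i => -[|[|[|i]]] hi //.
- by apply: e u0; apply: val_inj.
- by apply: e u1; apply: val_inj.
- by apply: e u2; apply: val_inj.
Qed.

Lemma subalg_zvec (J : Type) (l : X -> 'cV[CC]_3) (w1 w2 w3 : J -> X -> 'cV[CC]_3) j h i :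
  subalg_col l -> (forall q, subalg_col (w1 q)) -> (forall q, subalg_col (w2 q)) ->
  (forall q, subalg_col (w3 q)) ->
  subalg_col (fun x => zvec (l x) (w1^~ x) (w2^~ x) (w3^~ x) j h i).
Proof.
move=> Pl P1 P2 P3.
have K p q r : P (fun x => kappa (l x) (w1^~ x) (w2^~ x) (w3^~ x) p q r).
  by do 2?[apply: subalg_mul => //]; apply: subalg_det3.
by do 2?[apply: subalg_colD => //]; apply: subalg_colZ.
Qed.
End Subalgebra.

Definition upoly (h : CC -> CC) := exists q : {poly CC}, forall t, q.[t] = h t.

Lemma upoly_subalg : subalgebra upoly.
Proof.
split.
- by move=> f g fg [q qE]; exists q => t; rewrite qE fg.
- by move=> c; exists c%:P => t; rewrite hornerC.
- by move=> f g [p pE] [q qE]; exists (p + q) => t; rewrite hornerD pE qE.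
- by move=> f g [p pE] [q qE]; exists (p * q) => t; rewrite hornerM pE qE.
Qed.

Lemma upoly_id : upoly id.
Proof. by exists 'X => t; rewrite hornerX. Qed.

(** In characteristic zero the naturals below [size q] are already too many distinct roots. *)
Lemma poly_vanish (q : {poly CC}) : (forall t, q.[t] = 0) -> q = 0.
Proof.
move=> q0; apply: (roots_geq_poly_eq0 (rs := [seq i%:R | i <- iota 0 (size q)])).
- by apply/allP => t _; apply/rootP.
- rewrite map_inj_uniq ?iota_uniq // => i j /eqP; rewrite (Num.Theory.eqr_nat).
  by move/eqP.
- by rewrite size_map size_iota.
Qed.

Lemma upoly_domain (f g : CC -> CC) : upoly f -> upoly g ->
  (forall t, f t * g t = 0) -> (forall t, f t = 0) \/ (forall t, g t = 0).
Proof.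
move=> [p pE] [q qE] H.
have /eqP : p * q = 0 by apply: poly_vanish => t; rewrite hornerM pE qE.
by rewrite mulf_eq0 => /orP[]/eqP e; [left|right] => t; rewrite -?pE -?qE e horner0.
Qed.

(** * Polynomial functions on a parameter space *)

Section ParamSpace.
Variable I : Type.
Implicit Types (a b : I -> CC) (g : (I -> CC) -> CC).

Definition line_pt a b (t : CC) : I -> CC := fun i => a i + t * (b i - a i).
(** Only polynomiality along each line is required: density arguments restrict to the line joining
    two points. *)
Definition polyfun g := forall a b, upoly (fun t => g (line_pt a b t)).

Lemma polyfun_subalg : subalgebra polyfun.
Proof.
split.
- by move=> f g fg Pf a b; apply: (subalg_ext upoly_subalg) (Pf a b) => t; apply: fg.
- by move=> c a b; apply: (subalg_const upoly_subalg).
- by move=> f g Pf Pg a b; apply: (subalg_add upoly_subalg).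
- by move=> f g Pf Pg a b; apply: (subalg_mul upoly_subalg).
Qed.

Lemma polyfun_coord i : polyfun (fun a => a i).
Proof.
move=> a b; apply: (subalg_add upoly_subalg); first exact: (subalg_const upoly_subalg).
by apply: (subalg_mul upoly_subalg); [exact: upoly_id|exact: (subalg_const upoly_subalg)].
Qed.

Lemma line_pt0 a b : line_pt a b 0 = a.
Proof. by apply: functional_extensionality => i; rewrite /line_pt mul0r addr0. Qed.

Lemma line_pt1 a b : line_pt a b 1 = b.
Proof. by apply: functional_extensionality => i; rewrite /line_pt mul1r addrC subrK. Qed.

(** On the line from [a] to [b] both restrictions are nonzero polynomials, at [t = 0] and [t = 1]
    respectively, so their product is nonzero. *)
Lemma polyfun_domain f g a b : polyfun f -> polyfun g -> f a != 0 -> g b != 0 ->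
  exists c, f c * g c != 0.
Proof.
move=> Pf Pg fa gb; apply: NNPP => H.
have [t|h|h] := upoly_domain (Pf a b) (Pg a b).
- by apply/eqP; apply: contraT => h; case: H; exists (line_pt a b t).
- by move: fa; rewrite -(line_pt0 a b) h eqxx.
- by move: gb; rewrite -(line_pt1 a b) h eqxx.
Qed.

Variables (m n : nat) (Psi : (I -> CC) -> 'M[CC]_(m, n)).
Hypothesis polyPsi : forall i j, polyfun (fun a => Psi a i j).

(** If a defining polynomial of [Z] were nonzero at some [Psi a], it would be nonzero at some
    [Psi c] with [g c != 0]. This lets later arguments assume that parameters are generic. *)
Lemma zclosed_dense (Z : mset m n) g a0 : zclosed Z -> polyfun g -> g a0 != 0 ->
  (forall a, g a != 0 -> Z (Psi a)) -> forall a, Z (Psi a).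
Proof.
move=> [Ps ZE] Pg ga H a; apply/ZE => p Pp.
have Pe : polyfun (fun a => mx_eval p (Psi a)).
  by apply: subalg_mx_eval => //; apply: polyfun_subalg.
apply/eqP; apply: contraT => pa; have [c] := polyfun_domain Pe Pg pa ga.
rewrite mulf_eq0 negb_or => /andP[/eqP pc gc]; case: pc.
by have /ZE := H c gc; apply.
Qed.
End ParamSpace.

(** * Closures, irreducibility and generic points *)

Section Zariski.
Variables (m n : nat).
Implicit Types (Z S : mset m n) (Y : 'M[CC]_(m, n)).

Lemma zclosed_inter (I : Type) (Z : I -> mset m n) :
  (forall i, zclosed (Z i)) -> zclosed (fun Y => forall i, Z i Y).
Proof.
move=> cZ; exists (fun p => exists i, forall Y, Z i Y -> mx_eval p Y = 0) => Y; split.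
  by move=> ZY p [ i ]; apply.
move=> H i; have [Ps ZE] := cZ i; apply/ZE => p Pp; apply: H; exists i => X.
by move/ZE; apply.
Qed.

Lemma zclosure_closed S : zclosed (zclosure S).
Proof.
apply: zclosed_inter => Z; exists (fun p => zclosed Z /\ (forall X, S X -> Z X) /\ forall X, Z X -> mx_eval p X = 0) => Y; split.
  by move=> H p [cZ [SZ]]; apply; apply: H.
by move=> H cZ SZ; have [Ps ZE] := cZ; apply/ZE => p Pp; apply: H; do 2?split=> //; move=> X /ZE; apply.
Qed.

Lemma sub_zclosure S Y : S Y -> zclosure S Y.
Proof. by move=> SY Z _; apply. Qed.

Lemma zclosure_min S Z : zclosed Z -> (forall Y, S Y -> Z Y) -> forall Y, zclosure S Y -> Z Y.
Proof. by move=> cZ SZ Y; apply. Qed.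

Definition mxpoly (h : 'M[CC]_(m, n) -> CC) := exists p, forall Y, mx_eval p Y = h Y.

Lemma mxpoly_subalg : subalgebra mxpoly.
Proof.
split.
- by move=> f g fg [q qE]; exists q => t; rewrite qE fg.
- by move=> c; exists (mpoly.mpolyC _ c) => t; rewrite /mx_eval mpoly.mevalC.
- by move=> f g [p pE] [q qE]; exists (p + q) => t; rewrite /mx_eval mpoly.mevalD -!/(mx_eval _ _) pE qE.
- by move=> f g [p pE] [q qE]; exists (p * q) => t; rewrite /mx_eval mpoly.mevalM -!/(mx_eval _ _) pE qE.
Qed.

Lemma mxpoly_coord i j : mxpoly (fun Y => Y i j).
Proof.
exists (mpoly.mpolyX _ (mpoly.mnm1 (mxvec_index i j))) => Y.
by rewrite /mx_eval mpoly.mevalXU mxvecE.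
Qed.

Lemma zclosed_mxpoly h : mxpoly h -> zclosed (fun Y => h Y = 0).
Proof.
move=> [p pE]; exists (eq p) => Y; rewrite -pE; split; first by move=> e _ <-.
by apply.
Qed.

Lemma zclosed_polyfun_sep (I : Type) (Psi : (I -> CC) -> 'M[CC]_(m, n)) Z a :
  (forall i j, polyfun (fun a => Psi a i j)) -> zclosed Z -> ~ Z (Psi a) ->
  exists g, [/\ polyfun g, g a != 0 & forall b, g b != 0 -> ~ Z (Psi b)].
Proof.
move=> PP [Ps ZE] Za; apply: NNPP => H; apply: Za; apply/ZE => p Pp.
apply/eqP; apply: contraT => pa; exfalso; apply: H.
exists (fun a => mx_eval p (Psi a)); split => //.
  by apply: subalg_mx_eval => //; apply: polyfun_subalg.
by move=> b /eqP pb /ZE /(_ p Pp).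
Qed.

(** If neither closed set contains the image of [Psi], two separating functions are nonzero at a
    common parameter, whose image lies in neither set. *)
Lemma zirreducible_closure (I : Type) (Psi : (I -> CC) -> 'M[CC]_(m, n)) Z :
  (forall i j, polyfun (fun a => Psi a i j)) -> zclosed Z ->
  (forall a, Z (Psi a)) ->
  (forall W, zclosed W -> (forall a, W (Psi a)) -> forall Y, Z Y -> W Y) ->
  zirreducible Z.
Proof.
move=> PP cZ ZP minZ; split => //; first by exists (Psi (fun=> 0)).
move=> A B cA cB ZAB.
case: (classic (forall a, A (Psi a))) => [hA|/not_all_ex_not[a Aa]].
  by left; apply: minZ.
case: (classic (forall a, B (Psi a))) => [hB|/not_all_ex_not[b Bb]].
  by right; apply: minZ.
have [f [Pf fa fA]] := zclosed_polyfun_sep PP cA Aa.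
have [g [Pg gb gB]] := zclosed_polyfun_sep PP cB Bb.
have [c] := polyfun_domain Pf Pg fa gb.
rewrite mulf_eq0 negb_or => /andP[/fA nA /gB nB].
by case: (ZAB _ (ZP c)).
Qed.

Lemma generic_avoid (I : Type) (Psi : (I -> CC) -> 'M[CC]_(m, n)) (T : eqType) (r : seq T) (Z : T -> mset m n) :
  (forall i j, polyfun (fun a => Psi a i j)) -> (forall t, zclosed (Z t)) ->
  (forall t, t \in r -> exists a, ~ Z t (Psi a)) ->
  exists g, [/\ polyfun g, exists a, g a != 0 &
    forall b, g b != 0 -> forall t, t \in r -> ~ Z t (Psi b)].
Proof.
move=> PP cZ; elim: r => [|t r IH] H.
  exists (fun=> 1); split; first exact: (subalg_const (polyfun_subalg _)).
    by exists (fun=> 0); apply: oner_neq0.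
  by [].
have [|g [Pg [a ga] gZ]] := IH; first by move=> s sr; apply: H; rewrite inE sr orbT.
have [|b Zb] := H t; first by rewrite inE eqxx.
have [f [Pf fb fZ]] := zclosed_polyfun_sep PP (cZ t) Zb.
exists (fun a => g a * f a); split; first exact: (subalg_mul (polyfun_subalg _)).
  exact: polyfun_domain ga fb.
move=> c; rewrite mulf_eq0 negb_or => /andP[gc fc] s; rewrite inE => /orP[/eqP ->|sr].
  exact: fZ.
exact: gZ.
Qed.
End Zariski.

(** Along the curve, a defining polynomial times [t] vanishes identically, hence so does the
    polynomial itself. *)
Lemma zclosed_curve m n (Z : mset m n) (Y : CC -> 'M[CC]_(m, n)) :
  zclosed Z -> (forall i j, upoly (fun t => Y t i j)) ->
  (forall t, t != 0 -> Z (Y t)) -> Z (Y 0).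
Proof.
move=> [Ps ZE] PY H; apply/ZE => p Pp.
have Pe : upoly (fun t => mx_eval p (Y t)) by apply: subalg_mx_eval => //; apply: upoly_subalg.
have [t|//|h] := upoly_domain Pe upoly_id.
  case: (eqVneq t 0) => [->|t0]; first by rewrite mulr0.
  by have /ZE -> := H t t0; rewrite ?mul0r.
by have /eqP := h 1; rewrite oner_eq0.
Qed.

(** * Dependence of columns *)

Section Dependence.
Variables m n : nat.
Implicit Types (Y : 'M[CC]_(m, n)) (S T : {set 'I_n}).

Lemma cols_dependentP Y S : cols_dependent Y S <->
  exists2 u : 'rV[CC]_#|S|, u != 0 & u *m (colsubset Y S)^T = 0.
Proof.
split=> [[c [[j jS cj] cS csum]]|[u u0 uY]].
  exists (\row_i c (enum_val i)).
    apply/eqP => /rowP /(_ (enum_rank_in jS j)).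
    by rewrite !mxE enum_rankK_in // => /eqP; rewrite (negPf cj).
  apply/rowP => i; rewrite !mxE; have /colP /(_ i) := csum; rewrite summxE mxE => {2}<-.
  rewrite (bigID (mem S)) /= [X in _ = _ + X]big1 ?addr0; last first.
    by move=> x xS; rewrite cS // scale0r mxE.
  by rewrite [RHS]big_enum_val /=; apply: eq_bigr => x _; rewrite !mxE.
have [i ui] : exists i, u 0 i != 0 by apply/rV0Pn.
exists (fun x => if [pick i | enum_val i == x] is Some i then u 0 i else 0).
have E (h : 'I_#|S|) : (if [pick i | enum_val i == enum_val h] is Some i then u 0 i else 0) = u 0 h.
  by case: pickP => [d /eqP /enum_val_inj ->|/(_ h)] //; rewrite eqxx.
split.
- by exists (enum_val i); rewrite ?enum_valP // E.
- by move=> x xS; case: pickP => // d /eqP e; move: xS; rewrite -e enum_valP.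
- apply/colP => h; rewrite summxE mxE (bigID (mem S)) /= [X in _ + X]big1 ?addr0; last first.
    move=> x xS; case: pickP => [d /eqP e|]; first by move: xS; rewrite -e enum_valP.
    by rewrite scale0r mxE.
  have /rowP /(_ h) := uY; rewrite !mxE => e; rewrite -[RHS]e.
  by rewrite [LHS]big_enum_val /=; apply: eq_bigr => x _; rewrite E !mxE.
Qed.

Lemma cols_dependent_rank Y S : cols_dependent Y S <-> (\rank (colsubset Y S) < #|S|)%N.
Proof.
rewrite cols_dependentP -mxrank_tr ltn_neqAle rank_leq_row andbT -/(row_free _) -kermx_eq0.
split=> [[u u0 uY]|/rowV0Pn[u /sub_kermxP uY u0]]; last by exists u.
by apply/rowV0Pn; exists u => //; apply/sub_kermxP.
Qed.

(** At a matrix with independent columns in [S], a right inverse [B] of the transposed columns gives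
    a determinant equal to 1 there and to 0 at every dependent matrix. No choice of minors is
    needed. *)
Lemma zclosed_dependent S : zclosed (fun Y => cols_dependent Y S).
Proof.
exists (fun p => forall Y, cols_dependent Y S -> mx_eval p Y = 0) => Y; split.
  by move=> H p; apply.
move=> H; apply: NNPP => YS.
have /row_freeP[B YB] : row_free (colsubset Y S)^T.
  apply/negPn/negP => hr; apply: YS; rewrite cols_dependent_rank -mxrank_tr.
  by rewrite ltn_neqAle rank_leq_row andbT.
have [p pE] : mxpoly (fun X => \det ((colsubset X S)^T *m B)).
  apply: (subalg_det (mxpoly_subalg m n)) => i j.
  apply: (subalg_ext (mxpoly_subalg m n)
    (f := fun X => \sum_h X h (enum_val i) * B h j)) => [X|].
    by rewrite mxE; apply: eq_bigr => h _; rewrite !mxE.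
  apply: (subalg_sum (mxpoly_subalg m n)) => h.
  apply: (subalg_mul (mxpoly_subalg m n)); first exact: mxpoly_coord.
  exact: (subalg_const (mxpoly_subalg m n)).
have /eqP := pE Y; rewrite YB det1 H ?(eq_sym _ 1) ?oner_eq0 // => X.
rewrite cols_dependentP pE => -[u u0 uX]; apply/eqP/det0P; exists u => //.
by rewrite mulmxA uX mul0mx.
Qed.

Lemma cols_dependent_mono Y S T : S \subset T -> cols_dependent Y S -> cols_dependent Y T.
Proof.
move=> ST [c [[j jS cj] cS cY]]; exists c; split => //.
  by exists j => //; apply: (subsetP ST).
by move=> i iT; apply: cS; apply: contra iT; apply: (subsetP ST).
Qed.

Lemma cols_dependent_factor d (G : 'M[CC]_(m, d)) Y S : (\rank G < #|S|)%N ->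
  (forall x, x \in S -> exists u, col x Y = G *m u) -> cols_dependent Y S.
Proof.
move=> rG H; apply/cols_dependent_rank; apply: leq_ltn_trans rG.
rewrite -mxrank_tr -[X in (_ <= X)%N]mxrank_tr; apply: mxrankS.
apply/row_subP => i; have [u uE] := H _ (enum_valP i).
suff -> : row i (colsubset Y S)^T = u^T *m G^T by apply: submxMl.
rewrite -trmx_mul -uE; apply/rowP => j; by rewrite !mxE.
Qed.
End Dependence.

Lemma card_set3_le (T : finType) (x y z : T) : (#|[set x; y; z]| <= 3)%N.
Proof.
apply: leq_trans (leq_card_setU _ _) _; rewrite cards1 addn1 ltnS.
by rewrite cards2; case: (_ != _).
Qed.

Lemma card_set3 (T : finType) (x y z : T) : x != y -> x != z -> y != z ->
  #|[set x; y; z]| = 3%N.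
Proof.
move=> xy xz yz; rewrite setUC cardsU1 cards2 xy !inE negb_or.
by rewrite eq_sym xz eq_sym yz.
Qed.

(** * Dependence in three-space *)

Section Dependence3.

Variable n : nat.
Implicit Types (Y : 'M[CC]_(3, n)) (S : {set 'I_n}).

Lemma mul_tr_dot (l u : 'cV[CC]_3) : l^T *m u = (dot l u)%:M.
Proof.
apply/matrixP => i j; rewrite !ord1 !mxE eqxx mulr1n !big_ord_recl big_ord0 !mxE addr0.
rewrite addrA /dot /x0 /x1 /x2.
by congr (_ + _ + _); congr (_ * _); congr (_ _ _); apply: val_inj.
Qed.

Lemma cols_dependent_orth (l : 'cV[CC]_3) Y S : l != 0 -> (2 < #|S|)%N ->
  (forall x, x \in S -> dot l (col x Y) = 0) -> cols_dependent Y S.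
Proof.
move=> l0 S3 H; apply/cols_dependent_rank; apply: leq_trans S3; rewrite ltnS.
have lY : l^T *m colsubset Y S = 0.
  apply/rowP => i; rewrite mxE [RHS]mxE -[RHS](H _ (enum_valP i)).
  have /matrixP /(_ 0 0) := mul_tr_dot l (col (enum_val i) Y).
  rewrite !mxE eqxx mulr1n => e; rewrite -[RHS]e; by apply: eq_bigr => j _; rewrite !mxE.
by have := mulmx0_rank_max lY; rewrite rank_rV trmx_eq0 l0.
Qed.

Lemma cols_dependent_cross (l : 'cV[CC]_3) Y S : (2 < #|S|)%N ->
  (forall x, x \in S -> exists w, col x Y = cross l w) -> cols_dependent Y S.
Proof.
move=> S3 H; case: (eqVneq l 0) => [l0|l0]; last first.
  by apply: cols_dependent_orth l0 S3 _ => x /H[w ->]; rewrite dot_crossl.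
apply: (@cols_dependent_orth (vec3 1 0 0)) S3 _ => [|x /H[w ->]].
  by apply/eqP => /(congr1 (@x0 _))/eqP; rewrite !coordE oner_eq0.
by rewrite l0 cross0l dot0r.
Qed.

Lemma cols_dependent_line (u : 'cV[CC]_3) Y S : (1 < #|S|)%N ->
  (forall x, x \in S -> exists c, col x Y = c *: u) -> cols_dependent Y S.
Proof.
move=> S2 H; apply: (@cols_dependent_factor _ _ _ u) => [|x /H[c ->]].
  by rewrite -mxrank_tr rank_rV (leq_ltn_trans _ S2) // leq_b1.
by exists c%:M; rewrite mul_mx_scalar.
Qed.

Lemma cols_dependent_card Y S : (3 < #|S|)%N -> cols_dependent Y S.
Proof. by move=> S4; apply/cols_dependent_rank; rewrite (leq_ltn_trans _ S4) // rank_leq_row. Qed.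

Lemma cols_dependent_det3 Y x y z : cols_dependent Y [set x; y; z] ->
  det3 (col x Y) (col y Y) (col z Y) = 0.
Proof.
case=> c [[j jS cj] cS csum].
have sc u v : \sum_i c i * det3 (col i Y) u v = 0.
  transitivity (det3 (\sum_i c i *: col i Y) u v); last by rewrite csum det3_0l.
  elim/big_rec2: _ => [|i a b _ ->]; first by rewrite det3_0l.
  by rewrite det3D1 det3Z1.
(* Pairing the relation with two columns isolates the coefficient of the third. *)
have one t u v : (forall i, i != t -> c i = 0 \/ det3 (col i Y) u v = 0) ->
    c t * det3 (col t Y) u v = 0.
  move=> h; rewrite -(sc u v) (bigD1 t) //= big1 ?addr0 // => i /h[->|->];
  by rewrite ?mul0r ?mulr0.
have cycle (a b d : 'cV[CC]_3) : det3 a b d = det3 b d a.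
  by rewrite /det3 /dot /cross !coordE; ring.
have other i : i != x -> i != y -> i != z -> c i = 0.
  by move=> ix iy iz; apply: cS; rewrite !inE !negb_or ix iy iz.
have rep (a b : 'cV[CC]_3) : det3 a a b = 0 by rewrite /det3 /dot /cross !coordE; ring.
have rep' (a b : 'cV[CC]_3) : det3 a b a = 0 by rewrite -cycle rep.
have pick t u v a b : [set t; a; b] = [set x; y; z] -> u = col a Y -> v = col b Y ->
    c t * det3 (col t Y) u v = 0.
  move=> e -> ->; apply: one => i it.
  case: (eqVneq i a) => [->|ia]; first by right; apply: rep.
  case: (eqVneq i b) => [->|ib]; first by right; apply: rep'.
  by left; apply: cS; rewrite -e !inE !negb_or it ia ib.
move: jS cj; rewrite !inE -orbA => /or3P[]/eqP -> /negPf cj.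
- by have /eqP := @pick x _ _ y z erefl erefl erefl; rewrite mulf_eq0 cj => /eqP.
- have e : [set y; z; x] = [set x; y; z].
    by apply/setP => i; rewrite !inE; do 3!case: (i == _).
  by have /eqP := pick y _ _ z x e erefl erefl; rewrite mulf_eq0 cj -cycle => /eqP.
- have e : [set z; x; y] = [set x; y; z].
    by apply/setP => i; rewrite !inE; do 3!case: (i == _).
  by have /eqP := pick z _ _ x y e erefl erefl; rewrite mulf_eq0 cj cycle => /eqP.
Qed.

Lemma common_orth_dependent Y S :
  (forall T : {set 'I_n}, T \subset S -> #|T| = 3%N -> cols_dependent Y T) ->
  exists2 l : 'cV[CC]_3, l != 0 & forall x, x \in S -> dot l (col x Y) = 0.
Proof.
move=> H; apply: (@common_orth _ _ (mem S) (fun x => col x Y)) => x y z xS yS zS.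
case: (eqVneq x y) => [->|xy]; first by rewrite /det3 /dot /cross !coordE; ring.
case: (eqVneq x z) => [->|xz]; first by rewrite /det3 /dot /cross !coordE; ring.
case: (eqVneq y z) => [->|yz]; first by rewrite det3uu.
apply: cols_dependent_det3; apply: H; last exact: card_set3.
by apply/subsetP => t; rewrite !inE -orbA => /or3P[]/eqP ->.
Qed.

Definition std3 (i : nat) : 'cV[CC]_3 := \col_h (val h == i)%:R.

Lemma cols_independent_std Y S (s : 'I_n -> nat) (a : 'I_n -> CC) :
  {in S &, injective s} -> (forall x, x \in S -> (s x < 3)%N) ->
  (forall x, x \in S -> a x != 0) ->
  (forall x, x \in S -> col x Y = a x *: std3 (s x)) -> ~ cols_dependent Y S.
Proof.
move=> si s3 a0 YE [c [[j jS cj] cS csum]].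
have /colP /(_ (Ordinal (s3 j jS))) := csum; rewrite summxE mxE (bigD1 j) //=.
rewrite big1 => [/eqP|i ij].
  by rewrite addr0 YE // !mxE /= eqxx mulr1 mulf_eq0 (negPf cj) (negPf (a0 j jS)).
case iS: (i \in S); last by rewrite cS ?iS // scale0r mxE.
rewrite YE // !mxE /=; case: eqP => [/esym e|_]; last by rewrite !mulr0.
by rewrite (si i j iS jS e) eqxx in ij.
Qed.
End Dependence3.

(** * Three edges mapped to a triangle *)

Section Colouring.

(** Three distinct edges, none a loop, without a common vertex. A common vertex would be an end of
    the first edge, so [star] is tested only at [u1] and [v1]. *)
Definition edges_ok (T : eqType) (u1 v1 u2 v2 u3 v3 : T) : bool :=
  let same a b c d := ((a == c) && (b == d)) || ((a == d) && (b == c)) in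
  let star a := ((a == u2) || (a == v2)) && ((a == u3) || (a == v3)) in
  [&& u1 != v1, u2 != v2, u3 != v3, ~~ same u1 v1 u2 v2, ~~ same u1 v1 u3 v3,
      ~~ same u2 v2 u3 v3, ~~ star u1 & ~~ star v1].

(** The sum of the end colours, 1, 2 or 3, identifies an edge of the triangle on 0, 1, 2. *)
Definition colouring_ok (c1 d1 c2 d2 c3 d3 : nat) : bool :=
  [&& c1 < 3, d1 < 3, c2 < 3, d2 < 3, c3 < 3 & d3 < 3]%N &&
  [&& c1 != d1, c2 != d2, c3 != d3, c1 + d1 != c2 + d2,
      c1 + d1 != c3 + d3 & c2 + d2 != c3 + d3]%N.

Definition colourings : seq (seq nat) :=
  let three := [:: 0; 1; 2]%N in
  [seq a :: s | a <- three, s <- [seq a :: s | a <- three, s <-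
    [seq a :: s | a <- three, s <- [seq a :: s | a <- three, s <-
      [seq a :: s | a <- three, s <- [seq [:: a] | a <- three]]]]]].

(** Three edges have at most six ends. Numbered by first occurrence they lie below 6, with first
    edge 0, 1, so the remaining cases are finitely many and are checked by computation. *)
Lemma edges_colouring_nat (u2 v2 u3 v3 : nat) :
  (u2 < 6)%N -> (v2 < 6)%N -> (u3 < 6)%N -> (v3 < 6)%N ->
  edges_ok 0%N 1%N u2 v2 u3 v3 ->
  exists c : nat -> nat, colouring_ok (c 0%N) (c 1%N) (c u2) (c v2) (c u3) (c v3).
Proof.
move=> h1 h2 h3 h4 ok.
have : all (fun a => all (fun b => all (fun c => all (fun d =>
   edges_ok 0%N 1%N a b c d ==> has (fun s => colouring_ok (nth 0 s 0) (nth 0 s 1)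
     (nth 0 s a) (nth 0 s b) (nth 0 s c) (nth 0 s d))%N colourings) (iota 0 6)) (iota 0 6)) (iota 0 6)) (iota 0 6).
  by vm_compute.
move/allP/(_ u2); rewrite mem_iota h1 => /(_ isT) /allP /(_ v2); rewrite mem_iota h2.
move/(_ isT)/allP/(_ u3); rewrite mem_iota h3 => /(_ isT) /allP /(_ v3).
by rewrite mem_iota h4 ok => /(_ isT) /hasP[s _ H]; exists (nth 0%N s).
Qed.

(* Sending the vertices of the triangle to the standard basis turns its edges into independent cross products. *)
Lemma edges_colouring (T : eqType) (u1 v1 u2 v2 u3 v3 : T) :
  edges_ok u1 v1 u2 v2 u3 v3 ->
  exists c : T -> nat, colouring_ok (c u1) (c v1) (c u2) (c v2) (c u3) (c v3).
Proof.
move=> ok; pose s := [:: u1; v1; u2; v2; u3; v3]; pose g := index^~ s.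
have gE a b : a \in s -> b \in s -> (g a == g b) = (a == b).
  move=> sa sb; apply/eqP/eqP => [e|-> //].
  by rewrite -(nth_index u1 sa) -(nth_index u1 sb) -/(g a) e.
have g6 a : a \in s -> (g a < 6)%N by rewrite -index_mem.
have [m1 m2] : u1 \in s /\ v1 \in s by rewrite !inE !eqxx ?orbT.
have [m3 m4] : u2 \in s /\ v2 \in s by rewrite !inE !eqxx ?orbT.
have [m5 m6] : u3 \in s /\ v3 \in s by rewrite !inE !eqxx ?orbT.
have g0 : g u1 = 0%N by rewrite /g /= eqxx.
have g1 : g v1 = 1%N.
  by move/and3P: ok => [/negPf e _ _]; rewrite /g /= e eqxx.
have [|c cP] := edges_colouring_nat (g6 _ m3) (g6 _ m4) (g6 _ m5) (g6 _ m6).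
  by rewrite -g1 -g0 /edges_ok !gE.
by exists (c \o g); rewrite /= g0 g1.
Qed.

Definition same_edge (T : eqType) (e f : T * T) : bool :=
  ((e.1 == f.1) && (e.2 == f.2)) || ((e.1 == f.2) && (e.2 == f.1)).
Definition incident (T : eqType) (v : T) (e : T * T) : bool := (v == e.1) || (v == e.2).

Lemma colouring_le3 (X T : eqType) (e : X -> T * T) (s : seq X) :
  (size s <= 3)%N -> uniq s -> (forall x, x \in s -> (e x).1 != (e x).2) ->
  {in s &, forall x y, x != y -> ~~ same_edge (e x) (e y)} ->
  (size s = 3%N -> forall v, ~~ all (fun x => incident v (e x)) s) ->
  exists c : T -> nat,
    (forall x, x \in s -> [&& c (e x).1 < 3, c (e x).2 < 3 & c (e x).1 != c (e x).2]%N) /\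
    {in s &, injective (fun x => (c (e x).1 + c (e x).2)%N)}.
Proof.
case: s => [|x [|y [|z [|t s]]]] // _.
- by move=> *; exists (fun=> 0%N).
- move=> _ H _ _; exists (fun v => if v == (e x).1 then 0%N else 1%N); split.
    by move=> a; rewrite inE => /eqP ->; rewrite eqxx eq_sym (negPf (H x _)) ?inE.
  by move=> a b; rewrite !inE => /eqP -> /eqP ->.
- rewrite /= inE andbT => xy H1 H2 _.
  have H2' := H2 x y; rewrite !inE !eqxx orbT in H2'; move/(_ isT isT xy): H2' => nxy.
  have hx : (e x).1 != (e x).2 by apply: H1; rewrite inE eqxx.
  have hy : (e y).1 != (e y).2 by apply: H1; rewrite !inE eqxx orbT.
  (* Two edges are completed to three by an edge between the fresh vertices [inr 0] and [inr 1]. *)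
  have [|c /and3P[/and3P[a1 a2 /and4P[a3 a4 _ _]] b1 /and3P[b2 _ /and3P[b3 _ _]]]] := @edges_colouring (T + nat)%type (inl (e x).1) (inl (e x).2) (inl (e y).1) (inl (e y).2) (inr 0%N) (inr 1%N).
    by rewrite /edges_ok !(inj_eq (@inl_inj _ _)) /= hx hy /= !andbF /= andbT.
  exists (c \o inl); split => [a|a b]; rewrite !inE.
    by case/orP => /eqP -> /=; apply/and3P.
  move=> /orP[]/eqP -> /orP[]/eqP -> //= /eqP; first by rewrite (negPf b3).
  by rewrite eq_sym (negPf b3).
- rewrite /= !inE !andbT negb_or => /andP[/andP[xy xz] yz] H1 H2 H3.
  have hx : (e x).1 != (e x).2 by apply: H1; rewrite inE eqxx.
  have hy : (e y).1 != (e y).2 by apply: H1; rewrite !inE eqxx orbT.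
  have hz : (e z).1 != (e z).2 by apply: H1; rewrite !inE eqxx !orbT.
  have hxy : ~~ same_edge (e x) (e y) by apply: H2; rewrite ?inE ?eqxx ?orbT.
  have hxz : ~~ same_edge (e x) (e z) by apply: H2; rewrite ?inE ?eqxx ?orbT.
  have hyz : ~~ same_edge (e y) (e z) by apply: H2; rewrite ?inE ?eqxx ?orbT.
  have [|c /andP[/and3P[a1 a2 /and4P[a3 a4 a5 a6]] /and3P[b1 b2 /and4P[b3 b4 b5 b6]]]] := @edges_colouring T (e x).1 (e x).2 (e y).1 (e y).2 (e z).1 (e z).2.
    rewrite /edges_ok hx hy hz /= hxy hxz hyz /=.
    have := H3 erefl (e x).1; rewrite /= andbT /incident eqxx /= => -> /=.
    by have := H3 erefl (e x).2; rewrite /= andbT /incident eqxx orbT.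
  exists c; split => [a|a b]; rewrite !inE.
    by case/or3P => /eqP -> /=; apply/and3P.
  by move=> /or3P[]/eqP -> /or3P[]/eqP -> //= /eqP; rewrite ?(negPf b4) ?(negPf b5) ?(negPf b6) // eq_sym ?(negPf b4) ?(negPf b5) ?(negPf b6).
Qed.

Lemma cross_std3 i j : (i < 3)%N -> (j < 3)%N -> i != j ->
  exists2 a : CC, a != 0 & cross (std3 i) (std3 j) = a *: std3 (3 - (i + j)).
Proof.
have n1 : (-1 : CC) != 0 by rewrite oppr_eq0 oner_eq0.
have p1 := oner_neq0 CC.
case: i => [|[|[|i]]] //; case: j => [|[|[|j]]] // _ _ _;
  by [exists 1 => //; apply: col3P; rewrite /cross !coordE /x0 /x1 /x2 !mxE /=; ring
     |exists (-1) => //; apply: col3P; rewrite /cross !coordE /x0 /x1 /x2 !mxE /=; ring].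
Qed.
End Colouring.

(** * Configurations of the grid *)

Section Grid.
Variables k l : nat.
Hypotheses (hk : (3 <= k)%N) (hl : (3 <= l)%N).
Local Notation line := (line k l).
Local Notation block := {set line}.
Local Notation point := 'I_(k * l).

Let k_gt0 : (0 < k)%N. Proof. exact: leq_trans hk. Qed.
Let l_gt0 : (0 < l)%N. Proof. exact: leq_trans hl. Qed.

Lemma colof_subproof (x : point) : (x %/ k < l)%N.
Proof. by rewrite ltn_divLR // [(l * k)%N]mulnC. Qed.

(** [e1 x] is the row through [x], and [e2 x] the column. *)
Definition e1 (x : point) : line := inl (Ordinal (ltn_pmod x k_gt0)).
Definition e2 (x : point) : line := inr (Ordinal (colof_subproof x)).

Lemma pt_subproof (i : 'I_k) (j : 'I_l) : (j * k + i < k * l)%N.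
Proof.
apply: (@leq_trans (j.+1 * k)); first by rewrite mulSn addnC ltn_add2r.
by rewrite mulnC leq_mul2l ltn_ord orbT.
Qed.

Definition pt i j : point := Ordinal (pt_subproof i j).

Lemma e1_pt i j : e1 (pt i j) = inl i.
Proof. by congr inl; apply: val_inj; rewrite /= modnMDl modn_small. Qed.

Lemma e2_pt i j : e2 (pt i j) = inr j.
Proof. by congr inr; apply: val_inj; rewrite /= divnMDl // divn_small // addn0. Qed.

(** Rows are the side [true]. With the side as a parameter, one argument serves rows and columns. *)
Definition side (L : line) : bool := if L is inl _ then true else false.
Definition es (s : bool) (x : point) : line := if s then e1 x else e2 x.
(** Two lines of the same side receive an arbitrary default point. *)
Definition meet (L L' : line) : point :=
  match L, L' with
  | inl i, inr j | inr j, inl i => pt i j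
  | _, _ => pt (Ordinal k_gt0) (Ordinal l_gt0)
  end.

Lemma side_es s x : side (es s x) = s. Proof. by case: s. Qed.

Lemma meet_es s x : meet (es s x) (es (~~ s) x) = x.
Proof. by case: s; apply: val_inj; rewrite /= -divn_eq. Qed.

Lemma es_meet s L L' : side L = s -> side L' = ~~ s ->
  es s (meet L L') = L /\ es (~~ s) (meet L L') = L'.
Proof.
by case: s; case: L => L; case: L' => L' //= _ _; rewrite e1_pt e2_pt.
Qed.

Lemma in_line_set x L : (x \in line_set L) = (es (side L) x == L).
Proof. by case: L => i; rewrite /= inE. Qed.

Lemma in_Hset x (B : block) s : (x \in Hset B) = (es s x \in B) || (es (~~ s) x \in B).
Proof.
suff -> : (x \in Hset B) = (e1 x \in B) || (e2 x \in B) by case: s => //=; rewrite orbC.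
apply/bigcupP/orP => [[L LB]|[] h]; last 2 first.
- by exists (e1 x) => //; rewrite in_line_set eqxx.
- by exists (e2 x) => //; rewrite in_line_set eqxx.
rewrite in_line_set => /eqP; case: L LB => i LB /= e; rewrite e; by [left|right].
Qed.

Lemma card_side s : (3 <= #|[set L : line | side L == s]|)%N.
Proof.
case: s; [apply: leq_trans hk _|apply: leq_trans hl _].
  rewrite -[X in (X <= _)%N]card_ord -cardsT -(card_imset _ (@inl_inj _ 'I_l)).
  by apply/subset_leq_card/subsetP => L /imsetP[i _ ->]; rewrite inE.
rewrite -[X in (X <= _)%N]card_ord -cardsT -(card_imset _ (@inr_inj 'I_k _)).
by apply/subset_leq_card/subsetP => L /imsetP[i _ ->]; rewrite inE.
Qed.

(* A labelling b of the lines stands for a partition.  Every label carries a covector; a point whose two lines have distinct labels is a multiple of the cross product of their covectors, and a point whose two lines share a label uses an extra covector of its own. *)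
Definition vertex := (block + point)%type.
Definition param := (vertex * 'I_3 + point)%type.
Implicit Types (b : line -> block) (a : param -> CC).

Definition covector a (v : vertex) : 'cV[CC]_3 := \col_i a (inl (v, i)).
Definition scal a (x : point) : CC := a (inr x).
Definition src b (x : point) : vertex := inl (b (e1 x)).
Definition tgt b (x : point) : vertex :=
  if b (e1 x) == b (e2 x) then inr x else inl (b (e2 x)).
Definition Phi b a : 'M[CC]_(3, k * l) :=
  \matrix_(i, x) (scal a x *: cross (covector a (src b x)) (covector a (tgt b x))) i 0.
Definition mkparam (f : vertex -> 'cV[CC]_3) (c : point -> CC) : param -> CC :=
  fun i => match i with inl (v, i) => f v i 0 | inr x => c x end.
Definition im b : mset 3 (k * l) := fun Y => exists a, Y = Phi b a.

Lemma col_Phi b a x :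
  col x (Phi b a) = scal a x *: cross (covector a (src b x)) (covector a (tgt b x)).
Proof. by apply/colP => i; rewrite !mxE. Qed.

Lemma covector_mk f c v : covector (mkparam f c) v = f v.
Proof. by apply/colP => i; rewrite mxE. Qed.

Lemma polyfun_covector v : subalg_col (@polyfun param) (fun a => covector a v).
Proof.
by split; apply: (subalg_ext (polyfun_subalg _)) (polyfun_coord (inl (v, _))) => a;
  rewrite /x0 /x1 /x2 mxE.
Qed.

Lemma polyfun_Phi b i x : polyfun (fun a => Phi b a i x).
Proof.
have := subalg_coord i (subalg_colZ (polyfun_subalg _) (polyfun_coord (inr x))
  (subalg_cross (polyfun_subalg _) (polyfun_covector (src b x)) (polyfun_covector (tgt b x)))).
by apply: (subalg_ext (polyfun_subalg _)) => a; rewrite [in RHS]mxE.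
Qed.

Lemma eq_from_col (Y Z : 'M[CC]_(3, k * l)) : (forall x, col x Y = col x Z) -> Y = Z.
Proof.
by move=> H; apply/matrixP => i x; have /colP /(_ i) := H x; rewrite !mxE.
Qed.

(** A point killed by two independent covectors is a multiple of their cross product. A point whose
    lines share a label is killed by one covector [f] and has the form [cross f w], which supplies
    its own extra covector. *)
Lemma im_of_orth b (f : block -> 'cV[CC]_3) Y :
  (forall x, f (b (e1 x)) != 0) ->
  (forall s x, dot (f (b (es s x))) (col x Y) = 0) ->
  (forall x, b (e1 x) != b (e2 x) -> cross (f (b (e1 x))) (f (b (e2 x))) != 0) ->
  im b Y.
Proof.
move=> f0 fY ff.
have /fin_all_exists[w wP] x : exists w : 'cV[CC]_3,
    b (e1 x) == b (e2 x) -> col x Y = cross (f (b (e1 x))) w.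
  have [w ->] := orth_cross (f0 x) (fY true x); by exists w.
have /fin_all_exists[c cP] x : exists c : CC, col x Y =
   c *: cross (f (b (e1 x))) (if b (e1 x) == b (e2 x) then w x else f (b (e2 x))).
  case: ifPn => [h|h]; first by exists 1; rewrite scale1r wP.
  exact: orth_cross2 (ff x h) (fY true x) (fY false x).
exists (mkparam (fun v => match v with inl B => f B | inr x => w x end) c).
apply: eq_from_col => x; rewrite col_Phi !covector_mk cP /src /tgt.
by case: ifP.
Qed.

(** * The matroid of a partition and its parametrization *)

Section Matroid.
Variable Q : {set block}.
Hypothesis partQ : partition Q [set: line].
Local Notation b := (pblock Q).
Implicit Types (S T : {set point}) (x y : point) (L : line).

Lemma mem_pblockT L : L \in b L.
Proof. by rewrite mem_pblock (cover_partition partQ) inE. Qed.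

Lemma pblockT_mem L : b L \in Q.
Proof. by apply: pblock_mem; rewrite (cover_partition partQ) inE. Qed.

Lemma pblock_def L B : B \in Q -> L \in B -> b L = B.
Proof. by apply: def_pblock; case/and3P: partQ. Qed.

Lemma pblock_eq L B : B \in Q -> (L \in B) = (b L == B).
Proof.
move=> BQ; apply/idP/eqP => [|<-]; last exact: mem_pblockT.
exact: pblock_def.
Qed.

Lemma in_HsetQ x B s : B \in Q -> (x \in Hset B) = (b (es s x) == B) || (b (es (~~ s) x) == B).
Proof. by move=> BQ; rewrite (in_Hset _ _ s) !pblock_eq. Qed.

(** The condition for a Type 1 circuit without [x != y]; thus [parallel x x] says that the two lines
    of [x] lie in different blocks. *)
Definition parallel (x y : point) := exists B1 B2,
  [/\ B1 \in Q, B2 \in Q, B1 != B2 & [set x; y] \subset Hset B1 :&: Hset B2].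

Lemma circ1_set2 x y : x != y -> parallel x y -> circ1 Q [set x; y].
Proof. by move=> xy P; split; rewrite ?cards2 ?xy. Qed.

Lemma circ1P S : circ1 Q S -> exists x y, [/\ x != y, S = [set x; y] & parallel x y].
Proof. by case=> /eqP/cards2P[x [y [xy ->]]] h; exists x, y. Qed.

Lemma parallelP x y : parallel x y -> b (e1 x) != b (e2 x) /\
  ((b (e1 x) = b (e1 y) /\ b (e2 x) = b (e2 y)) \/ (b (e1 x) = b (e2 y) /\ b (e2 x) = b (e1 y))).
Proof.
case=> B1 [B2 [Q1 Q2 n12 /subsetP H]].
have := H x; have := H y; rewrite !inE !eqxx orbT !(in_HsetQ _ true) //=.
move=> /(_ isT)/andP[/orP[]/eqP y1 /orP[]/eqP y2] /(_ isT)/andP[/orP[]/eqP xx1 /orP[]/eqP xx2];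
  move: n12; rewrite -?xx1 -?xx2 ?eqxx // => n12; (split; first by rewrite // eq_sym);
  (try (by exfalso; move: n12; rewrite xx1 xx2 -y1 -y2 eqxx)); 
  rewrite ?y1 ?y2 xx1 xx2; by [left|right].
Qed.

Lemma parallelI x y : b (e1 x) != b (e2 x) ->
  ((b (e1 x) = b (e1 y) /\ b (e2 x) = b (e2 y)) \/ (b (e1 x) = b (e2 y) /\ b (e2 x) = b (e1 y))) ->
  parallel x y.
Proof.
move=> xx H; exists (b (e1 x)), (b (e2 x)); split; rewrite ?pblockT_mem //.
apply/subsetP => z; rewrite !inE !(in_HsetQ _ true) ?pblockT_mem //.
by case/orP => /eqP -> /=; rewrite ?eqxx ?orbT //; case: H => -[-> ->]; rewrite !eqxx ?orbT.
Qed.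

Lemma Gdependent_parallel S x y : x \in S -> y \in S -> x != y -> parallel x y -> Gdependent Q S.
Proof.
move=> xS yS xy P; exists [set x; y]; last by apply: Or31; apply: circ1_set2.
by apply/subsetP => z; rewrite !inE => /orP[]/eqP ->.
Qed.

(** A three-element subset of [S] contains a Type 1 circuit or is itself of Type 2. *)
Lemma Gdependent_block S B : (2 < #|S|)%N -> B \in Q -> S \subset Hset B -> Gdependent Q S.
Proof.
move=> S3 BQ SB; pose T := [set x in take 3 (enum S)].
have TS : T \subset S.
  by apply/subsetP => x; rewrite inE => /mem_take; rewrite mem_enum.
have T3 : #|T| = 3%N.
  by rewrite cardsE (card_uniqP _) ?take_uniq ?enum_uniq // size_takel // -cardE.
case: (classic (exists2 U : {set point}, U \subset T & circ1 Q U)) => [[U UT U1]|h].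
  by exists U; [exact: subset_trans UT TS | apply: Or31].
exists T => //; apply: Or32; split => //; first by exists B => //; apply: subset_trans TS SB.
by move=> U UT U1; apply: h; exists U.
Qed.

Lemma Gdependent_card S : (3 < #|S|)%N -> Gdependent Q S.
Proof.
move=> S3; pose T := [set x in take 4 (enum S)].
have TS : T \subset S.
  by apply/subsetP => x; rewrite inE => /mem_take; rewrite mem_enum.
have T4 : #|T| = 4%N.
  by rewrite cardsE (card_uniqP _) ?take_uniq ?enum_uniq // size_takel // -cardE.
case: (classic (exists2 U : {set point}, U \subset T & circ1 Q U)) => [[U UT U1]|h1].
  by exists U; [exact: subset_trans UT TS | apply: Or31].
case: (classic (exists2 U : {set point}, U \subset T & circ2 Q U)) => [[U UT U1]|h2].
  by exists U; [exact: subset_trans UT TS | apply: Or32].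
exists T => //; apply: Or33; split => // U UT U1; first by apply: h1; exists U.
by apply: h2; exists U.
Qed.

Lemma GdependentP S : Gdependent Q S ->
  [\/ (3 < #|S|)%N, exists x y, [/\ x \in S, y \in S, x != y & parallel x y] |
      exists T B, [/\ #|T| = 3%N, B \in Q, T \subset S & T \subset Hset B]].
Proof.
case=> T TS [/circ1P[x [y [xy e P]]]|[T3 [B BQ TB] _]|[T4 _ _]].
- by apply: Or32; exists x, y; split => //; apply: (subsetP TS); rewrite e !inE eqxx ?orbT.
- by apply: Or33; exists T, B.
- by apply: Or31; rewrite -T4 subset_leq_card.
Qed.

Lemma src_tgt_parallel a x y : parallel x y ->
  exists c, col y (Phi b a) = c *: cross (covector a (src b x)) (covector a (tgt b x)).
Proof.
case/parallelP => xx H; rewrite col_Phi /src /tgt (negPf xx).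
case: H => -[h1 h2]; first by exists (scal a y); rewrite -h1 -h2 (negPf xx).
exists (- scal a y); rewrite -h1 -h2 eq_sym (negPf xx).
by rewrite [in RHS]crossC scaleNr scalerN opprK.
Qed.

Lemma parallel_refl x y : parallel x y -> parallel x x.
Proof. by case/parallelP => h _; apply: parallelI => //; left. Qed.

Lemma Phi_dependent a S : Gdependent Q S -> cols_dependent (Phi b a) S.
Proof.
case/GdependentP => [S4|[x [y [xS yS xy P]]]|[T [B [T3 BQ TS TB]]]].
- exact: cols_dependent_card.
- apply: (@cols_dependent_mono _ _ _ [set x; y]).
    by apply/subsetP => z; rewrite !inE => /orP[]/eqP ->.
  apply: (cols_dependent_line (u := cross (covector a (src b x)) (covector a (tgt b x)))).
    by rewrite cards2 xy.
  by move=> z; rewrite !inE => /orP[]/eqP ->; apply: src_tgt_parallel => //; apply: parallel_refl P.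
- apply: (cols_dependent_mono TS); apply: (cols_dependent_cross (l := covector a (inl B))).
    by rewrite T3.
  move=> x /(subsetP TB); rewrite (in_HsetQ _ true) // col_Phi /src /tgt /= -crossZr.
  case: (eqVneq (b (e1 x)) (b (e2 x))) => [e|_] /orP[]/eqP h; first by rewrite h; eexists.
  + by rewrite e h; eexists.
  + by rewrite h; eexists.
  + by rewrite h crossC -crossNr crossZl -crossZr; eexists.
Qed.

(** A point is viewed as the edge from [src] to [tgt]. Independence leaves at most three edges,
    pairwise distinct and, if three, without a common vertex. Colouring them by a triangle and using
    basis covectors makes the points multiples of distinct basis vectors. *)
Lemma Phi_independent S : ~ Gdependent Q S -> exists a, ~ cols_dependent (Phi b a) S.
Proof.
move=> nG; pose e x := (src b x, tgt b x).
have [|||||c [c3 ci]] := @colouring_le3 _ _ e (enum S).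
- by rewrite -cardE leqNgt; apply/negP => /Gdependent_card.
- exact: enum_uniq.
- by move=> x _; rewrite /e /src /tgt /=; case: ifPn => // h; rewrite (inj_eq (@inl_inj _ _)).
- move=> x y; rewrite !mem_enum => xS yS xy; apply/negP => h; apply: nG.
  apply: (Gdependent_parallel xS yS xy); move: h; rewrite /same_edge /e /src /tgt /=.
  rewrite !(inj_eq (@inl_inj _ _)).
  case: ifPn => ex; case: ifPn => ey; rewrite ?(inj_eq (@inl_inj _ _)) ?(inj_eq (@inr_inj _ _)) ?(negPf xy) /= ?andbF ?orbF //.
  by case/orP => /andP[/eqP h1 /eqP h2]; apply: parallelI => //; [left|right].
- rewrite -cardE => S3 v; apply/negP => /allP H; apply: nG.
  have [x xS] : exists x, x \in S by apply/set0Pn; rewrite -card_gt0 S3.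
  (* A private vertex [inr z] lies only on the edge of [z], and [S] has another point. A common
     vertex [inl B] puts all of [S] into [Hset B]. *)
  case: v H => [B|z] H; last first.
    have [y [yS yz]] : exists y, y \in S /\ y != z.
      have /set0Pn[y] : S :\ z != set0.
        by rewrite -card_gt0; have := cardsD1 z S; rewrite S3; case: #|S :\ z| => [|? _ //]; case: (z \in S).
      by rewrite !inE => /andP[? ?]; exists y.
    have := H y; rewrite mem_enum yS => /(_ isT); rewrite /incident /e /src /tgt /=.
    by case: ifP => _ //; rewrite (inj_eq (@inr_inj _ _)) eq_sym (negPf yz).
  have inc y : y \in S -> (b (e1 y) == B) || (b (e2 y) == B).
    move=> yS; have := H y; rewrite mem_enum yS => /(_ isT).
    rewrite /incident /e /src /tgt /= (inj_eq (@inl_inj _ _)) eq_sym.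
    case/orP => [->//|]; case: ifP => _ //.
    by rewrite (inj_eq (@inl_inj _ _)) eq_sym => ->; rewrite orbT.
  have BQ : B \in Q by case/orP: (inc x xS) => /eqP <-; apply: pblockT_mem.
  apply: (@Gdependent_block S B); rewrite ?S3 //; apply/subsetP => y /inc.
  by rewrite (in_HsetQ _ true).
have cS x : x \in S -> [&& c (e x).1 < 3, c (e x).2 < 3 & c (e x).1 != c (e x).2]%N.
  by rewrite -mem_enum; apply: c3.
have /fin_all_exists[s sP] x : exists s : CC, x \in S -> s != 0 /\
    cross (std3 (c (src b x))) (std3 (c (tgt b x))) = s *: std3 (3 - (c (src b x) + c (tgt b x))).
  case xS: (x \in S); last by exists 0.
  have /and3P[h1 h2 h3] := cS x xS; have [s s0 sE] := cross_std3 h1 h2 h3; by exists s.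
have sum3 x : x \in S -> (0 < c (src b x) + c (tgt b x) <= 3)%N.
  move=> /cS /and3P[] /=; case: (c (src b x)) => [|[|[|?]]] //;
  by case: (c (tgt b x)) => [|[|[|?]]].
exists (mkparam (std3 \o c) (fun=> 1)).
apply: (cols_independent_std (s := fun x => (3 - (c (src b x) + c (tgt b x)))%N) (a := s)).
- move=> x y xS yS h; apply: ci; rewrite ?mem_enum //.
  have /andP[_ hx] := sum3 x xS; have /andP[_ hy] := sum3 y yS.
  by rewrite /= -(subKn hx) h subKn.
- by move=> x /sum3/andP[h _]; rewrite ltn_subrL h.
- by move=> x /sP[].
- by move=> x /sP[_ h]; rewrite col_Phi !covector_mk /scal /= scale1r h.
Qed.
End Matroid.
End Grid.

(** * Components *)

Section Components.
Variables k l : nat.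
Hypotheses (hk : (3 <= k)%N) (hl : (3 <= l)%N).
Local Notation line := (line k l).
Local Notation block := {set line}.
Local Notation point := 'I_(k * l).
Local Notation e1 := (e1 hk).
Local Notation e2 := (e2 hk).
Local Notation es := (es hk).
Local Notation meet := (meet hk hl).
Local Notation Phi := (Phi hk).
Local Notation im := (im hk).

(** The size condition on blocks, stated symmetrically in rows and columns. *)
Definition rich (B : block) : Prop :=
  (forall s, 3 <= #|[set L in B | side L == s]|)%N /\
  exists s, (4 <= #|[set L in B | side L == s]|)%N.

Definition partial (B : block) : Prop := forall s, exists2 L, side L = s & L \notin B.

Lemma card_side_lines (B : block) :
  #|B :&: Rlines k l| = #|[set L in B | side L == true]| /\
  #|B :&: Clines k l| = #|[set L in B | side L == false]|.
Proof. by split; apply: eq_card => L; rewrite !inE; case: L. Qed.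

Lemma admissibleP Q : admissible Q <-> partition Q [set: line] /\
  forall B, B \in Q -> (1 < #|B|)%N -> rich B /\ ((1 < #|Q|)%N -> partial B).
Proof.
split=> -[pQ H]; split=> // B BQ B1; have := H B BQ B1.
  have [-> ->] := card_side_lines B => -[h1 h2 h3 h4]; split; first split.
  - by case.
  - by move: h3; rewrite leq_max => /orP[h|h]; [exists true|exists false].
  - move/h4 => -[/subsetPn[L h5 h6] /subsetPn[L' h7 h8]] [].
      by exists L => //; move: h5; rewrite inE; case: L {h6}.
    by exists L' => //; move: h7; rewrite inE; case: L' {h8}.
have [-> ->] := card_side_lines B => -[[h1 [s h2]] h3]; split=> //.
  by rewrite leq_max; case: s h2 => ->; rewrite ?orbT.
move/h3 => h; split; apply/subsetPn.
  by have [L h4 h5] := h true; exists L => //; rewrite inE; case: L h4 {h5}.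
by have [L h4 h5] := h false; exists L => //; rewrite inE; case: L h4 {h5}.
Qed.

(** * Varieties of admissible partitions *)

Section Admissible.
Variable Q : {set block}.
Hypothesis admQ : admissible Q.
Local Notation b := (pblock Q).
Implicit Types (S T : {set point}) (x y z : point) (L : line) (B : block).

Let partQ : partition Q [set: line]. Proof. by case: admQ. Qed.

Lemma parallel_es s x y : parallel Q x y -> b (es s x) != b (es (~~ s) x) /\
  ((b (es s x) = b (es s y) /\ b (es (~~ s) x) = b (es (~~ s) y)) \/
   (b (es s x) = b (es (~~ s) y) /\ b (es (~~ s) x) = b (es s y))).
Proof.
case/(parallelP hk partQ) => h1 h2; case: s => /=; split=> //; first by rewrite eq_sym.
by case: h2 => -[-> ->]; [left|right].
Qed.

(** If the block of [L] is not a singleton, it contains two lines crossing [L], and their points on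
    [L] have both lines in one block. If it is a singleton, two crossing lines in different blocks
    give the pair. *)
Lemma nonparallel_pair L :
  exists x y, [/\ x \in line_set L, y \in line_set L, x != y & ~ parallel Q x y].
Proof.
have [_ aQ] := (admissibleP Q).1 admQ; set s := side L.
suff [c1 [c2 [s1 s2 c12 H]]] : exists c1 c2, [/\ side c1 = ~~ s, side c2 = ~~ s, c1 != c2 &
    ~ parallel Q (meet L c1) (meet L c2)].
  have [h1 h2] := es_meet hk hl (erefl (side L)) s1.
  have [h3 h4] := es_meet hk hl (erefl (side L)) s2.
  exists (meet L c1), (meet L c2); split; rewrite ?(in_line_set hk) ?h1 ?h3 //.
  by apply: contra c12 => /eqP e; rewrite -h2 -h4 e.
case: (ltnP 1 #|b L|) => B1.
  have [[/(_ (~~ s)) h3 _] _] := aQ _ (pblockT_mem partQ L) B1.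
  have /card_gt1P[c1 [c2 []]] := ltnW h3; rewrite !inE => /andP[c1B /eqP s1] /andP[c2B /eqP s2] c12.
  exists c1, c2; split=> // /(parallel_es s)[].
  have [-> ->] := es_meet hk hl (erefl (side L)) s1.
  by rewrite (pblock_def partQ (pblockT_mem partQ L) c1B) eqxx.
have bL L' : side L' = ~~ s -> b L' != b L.
  move=> s'; apply/eqP => e; have := card_le1_eqP B1 L' L; rewrite -{1}e !(mem_pblockT partQ).
  by move=> /(_ isT isT) e'; move: s'; rewrite -e' /s; case: (side L).
have /card_gt0P[c1] : (0 < #|[set c : line | side c == ~~ s]|)%N.
  exact: leq_trans (card_side hk hl (~~ s)).
rewrite inE => /eqP s1.
(* Otherwise one block contains the whole opposite side. It differs from the block of [L], so there
   are several blocks and admissibility forbids this. *)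
have [c2 s2 c12] : exists2 c2, side c2 = ~~ s & b c2 != b c1.
  apply: NNPP => nc.
  have sub c : side c = ~~ s -> c \in b c1.
    move=> sc; case: (eqVneq (b c) (b c1)) => [<-|h]; first exact: mem_pblockT.
    by case: nc; exists c.
  have c1B : (1 < #|b c1|)%N.
    apply: leq_trans (_ : (3 <= _)%N) => //; apply: leq_trans (card_side hk hl (~~ s)) _.
    by apply/subset_leq_card/subsetP => c; rewrite inE => /eqP /sub.
  have Q1 : (1 < #|Q|)%N.
    by apply/card_gt1P; exists (b c1), (b L); rewrite !(pblockT_mem partQ) bL.
  have [_ /(_ Q1) /(_ (~~ s)) [c sc]] := aQ _ (pblockT_mem partQ c1) c1B.
  by rewrite sub.
exists c1, c2; split=> //; first by apply: contra c12 => /eqP ->.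
case/(parallel_es s) => _.
have [-> ->] := es_meet hk hl (erefl (side L)) s1.
have [-> ->] := es_meet hk hl (erefl (side L)) s2.
case=> -[h1 h2]; first by rewrite h2 eqxx in c12.
by move: (bL c1 s1); rewrite h2 eqxx.
Qed.

Lemma line_set_Hset x L : x \in line_set L -> x \in Hset (b L).
Proof. by move=> xL; apply/bigcupP; exists L => //; apply: mem_pblockT. Qed.

Lemma parallelI2 x y B B' : B \in Q -> B' \in Q -> B != B' ->
  x \in Hset B -> x \in Hset B' -> y \in Hset B -> y \in Hset B' -> parallel Q x y.
Proof.
move=> BQ BQ' n h1 h2 h3 h4; exists B, B'; split=> //.
by apply/subsetP => z; rewrite !inE => /orP[]/eqP ->; apply/andP.
Qed.

Lemma parallel_Hset x y B : B \in Q -> parallel Q x y -> x \in Hset B -> y \in Hset B.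
Proof.
move=> BQ /(parallel_es true)[_ H]; rewrite !(in_HsetQ hk partQ _ true) //.
by case: H => -[-> ->] //; rewrite orbC.
Qed.

Lemma parallel_sym x y : parallel Q x y -> parallel Q y x.
Proof. by case=> B1 [B2 [? ? ? H]]; exists B1, B2; split=> //; rewrite setUC. Qed.

(** A point dependent on a non-parallel pair of [L] lies in [Hset (b L)]. If this held for all
    points of [L'], every two of them would lie in both blocks and be parallel. *)
Lemma independent_triple L L' : b L != b L' ->
  exists x y z, [/\ x \in line_set L, y \in line_set L, z \in line_set L',
    #|[set x; y; z]| = 3%N & ~ Gdependent Q [set x; y; z]].
Proof.
move=> LL'; have [x [y [xL yL xy nxy]]] := nonparallel_pair L.
have [x' [y' [xL' yL' xy' nxy']]] := nonparallel_pair L'.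
have BQ := pblockT_mem partQ L; have BQ' := pblockT_mem partQ L'.
have C z : Gdependent Q [set x; y; z] -> z \in Hset (b L).
  case/GdependentP => [h|[u [v []]]|[T [B [T3 TB TS TH]]]].
  - by move: h; rewrite ltnNge card_set3_le.
  - rewrite !inE -!orbA => /or3P[]/eqP -> /or3P[]/eqP -> //; rewrite ?eqxx // => _ h;
      first [by case: nxy | by case: nxy; apply: parallel_sym
            | by apply: (parallel_Hset BQ h); apply: line_set_Hset
            | by apply: (parallel_Hset BQ (parallel_sym h)); apply: line_set_Hset].
  - have eT : T = [set x; y; z].
      by apply/eqP; rewrite eqEcard TS T3 card_set3_le.
    rewrite eT in TH; case: (eqVneq B (b L)) => [<-|nB].
      by apply: (subsetP TH); rewrite !inE eqxx orbT.
    case: nxy; apply: (parallelI2 TB BQ nB); rewrite ?line_set_Hset //;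
      by apply: (subsetP TH); rewrite !inE eqxx ?orbT.
have [z zL' [zx zy nz]] : exists2 z, z \in line_set L' &
    [/\ x != z, y != z & ~ Gdependent Q [set x; y; z]].
  apply: NNPP => H; apply: nxy'.
  have D z : z \in line_set L' -> z \in Hset (b L).
    move=> zL'; case: (eqVneq x z) => [<-|zx]; first exact: line_set_Hset.
    case: (eqVneq y z) => [<-|zy]; first exact: line_set_Hset.
    by apply: C; apply: NNPP => nz; apply: H; exists z.
  by apply: (parallelI2 BQ BQ' LL'); rewrite ?D ?line_set_Hset.
by exists x, y, z; split=> //; apply: card_set3.
Qed.

(** Each block has a covector killing its points. Covectors of different blocks are independent,
    since otherwise the triple of [independent_triple] would be killed by one covector. *)
Lemma realization_im Y : realization Q Y -> im b Y.
Proof.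
move=> RY.
have /fin_all_exists[f fP] B : exists f : 'cV[CC]_3, B \in Q ->
    f != 0 /\ forall x, x \in Hset B -> dot f (col x Y) = 0.
  case BQ: (B \in Q); last by exists 0.
  have [S SB S3|f f0 fP] := @common_orth_dependent _ Y (Hset B); last by exists f.
  by apply/RY; apply: (@Gdependent_block _ _ _ _ B); rewrite ?S3.
have fQ L := fP _ (pblockT_mem partQ L).
apply: (im_of_orth (f := f)) => [x|s x|x xx].
- exact: (fQ (e1 x)).1.
- by apply: (fQ (es s x)).2; apply: line_set_Hset; rewrite (in_line_set hk) side_es.
- apply/eqP => h; have [u [v [w [uL vL wL S3 nS]]]] := independent_triple xx.
  have [k1 kE] := cross_eq0 (fQ (e2 x)).1 h.
  apply: nS; apply/RY; apply: (cols_dependent_orth (fQ (e1 x)).1); first by rewrite S3.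
  move=> t; rewrite !inE -orbA => /or3P[]/eqP ->.
  + by apply: (fQ (e1 x)).2; apply: line_set_Hset.
  + by apply: (fQ (e1 x)).2; apply: line_set_Hset.
  + by rewrite kE dotZl (fQ (e2 x)).2 ?mulr0 //; apply: line_set_Hset.
Qed.

(** Each of the finitely many independent sets is independent at some parameter, hence all are at a
    generic one. There [Phi b a] is a realization, and density gives the whole image. *)
Lemma im_VG Y : im b Y -> VG Q Y.
Proof.
have /fin_all_exists[d dP] S : exists d : bool, d <-> ~ Gdependent Q S.
  by case: (classic (Gdependent Q S)) => h; [exists false|exists true].
pose r := [seq S <- enum {set point} | d S].
have [||S|g [Pg [a0 ga0] gP]] := @generic_avoid 3 (k * l) _ (Phi b) _ r
    (fun S Y => cols_dependent Y S).
- exact: polyfun_Phi.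
- exact: zclosed_dependent.
- by rewrite mem_filter => /andP[/dP nS _]; apply: Phi_independent.
case=> a ->; apply: (zclosed_dense (@polyfun_Phi _ _ hk b) _ Pg ga0); first exact: zclosure_closed.
move=> c gc; apply: sub_zclosure => S; split=> [h|h]; last exact: Phi_dependent.
apply: NNPP => /dP dS; apply: (gP c gc S) h.
by rewrite mem_filter dS mem_enum.
Qed.

Lemma VG_sub_closed (Z : mset 3 (k * l)) :
  zclosed Z -> (forall a, Z (Phi b a)) -> forall Y, VG Q Y -> Z Y.
Proof. by move=> cZ H; apply: zclosure_min => // Y /realization_im[a ->]. Qed.

Lemma VG_irreducible : zirreducible (VG Q).
Proof.
apply: (zirreducible_closure (@polyfun_Phi _ _ hk b)).
- exact: zclosure_closed.
- by move=> a; apply: im_VG; exists a.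
- exact: VG_sub_closed.
Qed.

Lemma VG_dependent Y S : VG Q Y -> Gdependent Q S -> cols_dependent Y S.
Proof.
move=> YV GS; move: Y YV; apply: zclosure_min; first exact: zclosed_dependent.
by move=> Y RY; apply/RY.
Qed.

Lemma VG_VDelta Y : VG Q Y -> VDelta k l Y.
Proof.
move=> YV F F3 [L FL]; apply/cols_dependent_rank; apply: VG_dependent YV _.
apply: (Gdependent_block _ (pblockT_mem partQ L)); first by rewrite F3.
by apply: subset_trans FL _; apply/subsetP => x; apply: line_set_Hset.
Qed.
End Admissible.
End Components.

(** * Irredundancy *)

Section Irredundant.
Variables k l : nat.
Hypotheses (hk : (3 <= k)%N) (hl : (3 <= l)%N).
Local Notation line := (line k l).
Local Notation block := {set line}.
Local Notation point := 'I_(k * l).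
Local Notation e1 := (e1 hk).
Local Notation e2 := (e2 hk).
Local Notation es := (es hk).
Local Notation meet := (meet hk hl).
Local Notation Phi := (Phi hk).
Local Notation im := (im hk).
Implicit Types (b : line -> block) (x y : point).

Lemma Phi_orth b a s x : dot (covector a (inl (b (es s x)))) (col x (Phi b a)) = 0.
Proof.
rewrite col_Phi dotZr /src /tgt; case: s => /=; first by rewrite dot_crossl mulr0.
by case: eqP => [<-|_]; rewrite ?dot_crossl ?dot_crossr mulr0.
Qed.

(** * The separating polynomial of a 3 x 4 grid *)

Section GridPolynomial.
Variables (s : bool) (r : 'I_3 -> line) (c : 'I_4 -> line).
Hypotheses (sr : forall i, side (r i) = s) (sc : forall j, side (c j) = ~~ s).

Definition e3 : 'cV[CC]_3 := vec3 0 0 1.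
Let r0 : 'I_3 := @Ordinal 3 0 isT.
Let r1 : 'I_3 := @Ordinal 3 1 isT.
Let r2 : 'I_3 := @Ordinal 3 2 isT.
Let c0 : 'I_4 := @Ordinal 4 0 isT.
Let c1 : 'I_4 := @Ordinal 4 1 isT.
Let c2 : 'I_4 := @Ordinal 4 2 isT.
Let c3 : 'I_4 := @Ordinal 4 3 isT.

Definition gridcol (Y : 'M[CC]_(3, k * l)) i j := col (meet (r i) (c j)) Y.
Definition gridpoly (Y : 'M[CC]_(3, k * l)) : CC :=
  let w i j := gridcol Y i j in
  det3 e3 (zvec e3 (w r0) (w r1) (w r2) c0 c1 c2) (zvec e3 (w r0) (w r1) (w r2) c0 c1 c3).

Lemma mxpoly_gridpoly : mxpoly gridpoly.
Proof.
have A := mxpoly_subalg 3 (k * l).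
have C i j : subalg_col (@mxpoly 3 (k * l)) (fun Y => gridcol Y i j).
  by split; apply: (subalg_ext A) (mxpoly_coord _ _) => Y; rewrite /x0 /x1 /x2 mxE.
apply: (subalg_det3 A); first exact: subalg_col_cst.
- by apply: (subalg_zvec (l := fun=> e3) (w1 := fun j Y => gridcol Y r0 j)
   (w2 := fun j Y => gridcol Y r1 j) (w3 := fun j Y => gridcol Y r2 j) A) => //; apply: subalg_col_cst.
- by apply: (subalg_zvec (l := fun=> e3) (w1 := fun j Y => gridcol Y r0 j)
   (w2 := fun j Y => gridcol Y r1 j) (w3 := fun j Y => gridcol Y r2 j) A) => //; apply: subalg_col_cst.
Qed.

(* Dual affine chart: the common point of two lines is, modulo [e3], parallel to the difference of their images. *)
Definition chart (u : 'cV[CC]_3) : 'cV[CC]_3 := vec3 (x1 u / x2 u) (- (x0 u / x2 u)) 0.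

Lemma chart_orth (u v p : 'cV[CC]_3) : x2 u != 0 -> x2 v != 0 -> dot u p = 0 -> dot v p = 0 ->
  det3 e3 (chart u - chart v) p = 0.
Proof.
move=> u0 v0 up vp.
have -> : det3 e3 (chart u - chart v) p = dot u p / x2 u - dot v p / x2 v.
  by rewrite /det3 /dot /cross /chart !coordE; field; apply/andP.
by rewrite up vp !mul0r subrr.
Qed.

Lemma gridpoly_vanish b : b (r r0) != b (r r1) -> forall a, gridpoly (Phi b a) = 0.
Proof.
move=> b01; pose u (a : param k l -> CC) L := covector a (inl (b L)).
(* The products make all charts defined. The last factor is the numerator of the first coordinate of
   [z] below, so [z] is nonzero modulo [e3]. *)
pose g a := (\prod_i x2 (u a (r i))) * (\prod_j x2 (u a (c j))) *
  (x1 (u a (r r1)) * x2 (u a (r r0)) - x1 (u a (r r0)) * x2 (u a (r r1))).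
have A := polyfun_subalg (param k l).
have Pu L : subalg_col (@polyfun (param k l)) (u^~ L) by apply: polyfun_covector.
have P1 L : polyfun (fun a => x1 (u a L)) by case: (Pu L).
have P2 L : polyfun (fun a => x2 (u a L)) by case: (Pu L).
have Pg : polyfun g.
  apply: (subalg_mul A); first by apply: (subalg_mul A); apply: (subalg_prod A).
  by apply: (subalg_sub A); apply: (subalg_mul A).
pose a0 : param k l -> CC := mkparam (fun v => match v with
  inl B => if B == b (r r0) then vec3 0 1 1 else vec3 0 0 1 | inr _ => 0 end) (fun=> 0).
have ga0 : g a0 != 0.
  have x21 L : x2 (u a0 L) = 1 by rewrite /u covector_mk; case: ifP => _; rewrite coordE.
  rewrite /g !big1 // !x21 /u !covector_mk eqxx [b (r r1) == _]eq_sym (negPf b01) !coordE.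
  by rewrite !mulr1 mul1r sub0r oppr_eq0 oner_eq0.
apply: (@zclosed_dense _ _ _ _ _ (fun Y => gridpoly Y = 0) g a0) => //.
- exact: polyfun_Phi.
- exact: zclosed_mxpoly mxpoly_gridpoly.
move=> a; rewrite /g !mulf_eq0 !negb_or => /andP[/andP[/prodf_neq0 ur /prodf_neq0 uc] z0].
have ur' i : x2 (u a (r i)) != 0 by apply: ur.
have uc' i : x2 (u a (c i)) != 0 by apply: uc.
have E i j : det3 e3 (chart (u a (c j)) - chart (u a (r i))) (gridcol (Phi b a) i j) = 0.
  have [h1 h2] := es_meet hk hl (sr i) (sc j).
  apply: chart_orth => //; rewrite /u.
    by rewrite -{1}h2 Phi_orth.
  by rewrite -{1}h1 Phi_orth.
set z := chart (u a (r r1)) - chart (u a (r r0)).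
have Z1 : det3 e3 z _ = 0 := zvec_parallel c0 c1 c2 (E r0) (E r1) (E r2).
have Z2 : det3 e3 z _ = 0 := zvec_parallel c0 c1 c3 (E r0) (E r1) (E r2).
rewrite /gridpoly; apply: (det3_parallel Z1 Z2 (u := vec3 0 1 0)).
have -> : det3 e3 z (vec3 0 1 0) =
  (x1 (u a (r r1)) * x2 (u a (r r0)) - x1 (u a (r r0)) * x2 (u a (r r1)))
   / (x2 (u a (r r0)) * x2 (u a (r r1))).
  by rewrite /z /chart /det3 /dot /cross !coordE; field; rewrite !ur'.
by rewrite mulf_eq0 (negPf z0) invr_eq0 mulf_eq0 !(negPf (ur' _)).
Qed.

Hypotheses (ri : injective r) (ci : injective c).

Lemma meet_inj i j i' j' : (meet (r i) (c j) == meet (r i') (c j')) = (i == i') && (j == j').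
Proof.
apply/eqP/andP => [e|[/eqP -> /eqP ->] //].
have [h1 h2] := es_meet hk hl (sr i) (sc j).
have [h3 h4] := es_meet hk hl (sr i') (sc j').
by split; apply/eqP; [apply: ri; rewrite -h1 -h3 e|apply: ci; rewrite -h2 -h4 e].
Qed.

(* The two coordinate directions occur along two complementary spanning trees of the complete bipartite graph K_(3,4). *)
Definition tree : seq ('I_3 * 'I_4) :=
  [:: (r0, c0); (r0, c1); (r0, c3); (r1, c3); (r2, c1); (r2, c2)].

Lemma gridpoly_nonzero b B : (forall i, b (r i) = B) -> (forall j, b (c j) = B) ->
  exists a, gridpoly (Phi b a) != 0.
Proof.
move=> rB cB; pose t x := has (fun ij => x == meet (r ij.1) (c ij.2)) tree.
(* Every label carries [e3], so crossing with the extra covectors gives [vec3 1 0 0] on the tree and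
   [vec3 0 1 0] off it. *)
pose a : param k l -> CC := mkparam (fun v => match v with inl _ => e3
  | inr x => if t x then vec3 0 (-1) 0 else vec3 1 0 0 end) (fun=> 1).
exists a.
have E i j : gridcol (Phi b a) i j =
    if has (fun ij => (i == ij.1) && (j == ij.2)) tree then vec3 1 0 0 else vec3 0 1 0.
  have tE : t (meet (r i) (c j)) = has (fun ij => (i == ij.1) && (j == ij.2)) tree.
    by rewrite /t; apply: eq_has => ij; rewrite meet_inj.
  rewrite -tE /gridcol col_Phi (_ : scal a _ = 1) // scale1r /src /tgt.
  have [h1 h2] := es_meet hk hl (sr i) (sc j).
  have h3 : b (es s (meet (r i) (c j))) = B by rewrite h1.
  have h4 : b (es (~~ s) (meet (r i) (c j))) = B by rewrite h2.
  have [-> ->] : b (e1 (meet (r i) (c j))) = B /\ b (e2 (meet (r i) (c j))) = B.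
    by move: h3 h4; case: (s) => /= -> ->.
  rewrite eqxx !covector_mk; case: (t _); apply: col3P; rewrite /e3 /cross !coordE; ring.
have -> : gridpoly (Phi b a) = 1; last exact: oner_neq0.
have [pp qq] : det3 e3 (vec3 1 0 0) (vec3 1 0 0) = 0 /\ det3 e3 (vec3 0 1 0) (vec3 0 1 0) = 0.
  by split; apply: det3uu.
have pq : det3 e3 (vec3 1 0 0) (vec3 0 1 0) = 1.
  by rewrite /e3 /det3 /dot /cross !coordE; ring.
have qp : det3 e3 (vec3 0 1 0) (vec3 1 0 0) = -1 by rewrite det3C pq.
rewrite /gridpoly /zvec /kappa !E /= !(pp, qq, pq, qp).
rewrite !(mul0r, mulr0, mul1r, mulr1, scale0r, add0r, addr0, mulN1r, mulrN1, opprK, scale1r).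
rewrite /e3 /det3 /dot /cross !coordE; ring.
Qed.
End GridPolynomial.

(** * Comparison of two admissible partitions *)

Variables Q Q' : {set block}.
Hypotheses (admQ : admissible Q) (admQ' : admissible Q').
Hypothesis QQ' : forall Y, VG Q Y -> VG Q' Y.
Local Notation b := (pblock Q).
Local Notation b' := (pblock Q').

Let partQ : partition Q [set: line]. Proof. by case: admQ. Qed.
Let partQ' : partition Q' [set: line]. Proof. by case: admQ'. Qed.

(** A set independent in [Q] is independent at some point of [VG Q], hence of [VG Q'], where sets
    dependent in [Q'] are dependent. *)
Lemma Gdependent_sub (S : {set point}) : Gdependent Q' S -> Gdependent Q S.
Proof.
move=> G'; apply: NNPP => /(Phi_independent hk partQ)[a]; apply.
apply: (VG_dependent _ G'); apply: QQ'.
apply: (im_VG (hk := hk) admQ); by exists a.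
Qed.

Lemma pblock_refine L L' : b' L = b' L' -> b L = b L'.
Proof.
move=> e; apply/eqP/negPn/negP => /(independent_triple hk hl admQ).
case=> x [y [z [xL yL zL' S3]]]; apply; apply: Gdependent_sub.
apply: (Gdependent_block _ (pblockT_mem partQ' L)); first by rewrite S3.
apply/subsetP => t; rewrite !inE -orbA => /or3P[]/eqP ->.
- exact: line_set_Hset.
- exact: line_set_Hset.
- by rewrite e; apply: line_set_Hset.
Qed.

(** Suppose a piece of the cut block has two lines, and let [K] be a line of the block outside it.
    By richness two lines of the piece cross [K]; the crossing points are parallel for [Q'] but not
    for [Q], where all these lines share a block. *)
Lemma split_singletons L L' : b L = b L' -> b' L != b' L' ->
  {in b L &, injective b'}.
Proof.
move=> e n M N ML NL MN; apply/eqP/negPn/negP => nMN.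
have [_ aQ'] := (admissibleP Q').1 admQ'.
have B1 : (1 < #|b' M|)%N.
  by apply/card_gt1P; exists M, N; rewrite (mem_pblockT partQ') MN (mem_pblockT partQ').
have [K KL nK] : exists2 K, K \in b L & b' K != b' M.
  case: (eqVneq (b' L) (b' M)) => h; last by exists L => //; apply: mem_pblockT.
  by exists L'; rewrite ?e ?mem_pblockT // -h eq_sym.
have [[h _] _] := aQ' _ (pblockT_mem partQ' M) B1.
have /card_gt1P[c1 [c2 []]] := ltnW (h (~~ side K)).
rewrite !inE => /andP[c1M /eqP s1] /andP[c2M /eqP s2] c12.
have b1 := pblock_def partQ' (pblockT_mem partQ' M) c1M.
have b2 := pblock_def partQ' (pblockT_mem partQ' M) c2M.
have [h1 h2] := es_meet hk hl (erefl (side K)) s1.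
have [h3 h4] := es_meet hk hl (erefl (side K)) s2.
have xy : meet K c1 != meet K c2 by apply: contra c12 => /eqP xy; rewrite -h2 -h4 xy.
have P' : parallel Q' (meet K c1) (meet K c2).
  apply: (parallelI2 (B := b' K) (B' := b' M)) => //; rewrite ?(pblockT_mem partQ') //.
  - by rewrite (in_HsetQ hk partQ' _ (side K)) ?(pblockT_mem partQ') // h1 eqxx.
  - by rewrite (in_HsetQ hk partQ' _ (side K)) ?(pblockT_mem partQ') // h2 b1 eqxx orbT.
  - by rewrite (in_HsetQ hk partQ' _ (side K)) ?(pblockT_mem partQ') // h3 eqxx.
  - by rewrite (in_HsetQ hk partQ' _ (side K)) ?(pblockT_mem partQ') // h4 b2 eqxx orbT.
have : Gdependent Q [set meet K c1; meet K c2].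
  by apply: Gdependent_sub; apply: Gdependent_parallel xy P'; rewrite !inE eqxx ?orbT.
have bM : b M = b L by apply: pblock_def ML => //; apply: pblockT_mem.
have bK : b K = b L by apply: pblock_def KL => //; apply: pblockT_mem.
have bc1 : b c1 = b L by rewrite -bM; apply: pblock_refine.
have bc2 : b c2 = b L by rewrite -bM; apply: pblock_refine.
case/GdependentP => [|[u [v [uS vS _ /(parallel_es hk admQ (side K))[]]]]|[T [B [T3 _ TS _]]]].
- by rewrite cards2 xy.
- by move: uS; rewrite !inE => /orP[]/eqP ->; rewrite ?h1 ?h2 ?h3 ?h4 bK ?bc1 ?bc2 eqxx.
- by have := subset_leq_card TS; rewrite T3 cards2 xy.
Qed.

Lemma VG_sub_eq : Q = Q'.
Proof.
suff H L L' : b L = b L' -> b' L = b' L'.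
  have bb L : b L = b' L.
    apply/setP => L'; rewrite (pblock_eq partQ) ?pblockT_mem // (pblock_eq partQ') ?pblockT_mem //.
    by apply/eqP/eqP => h; [apply: H | apply: pblock_refine].
  apply/setP => B; apply/idP/idP => BQ.
    case: (set_0Vmem B) => [B0|[L LB]]; first by case/and3P: partQ; rewrite -B0 BQ.
    by rewrite -(pblock_def partQ BQ LB) bb (pblockT_mem partQ').
  case: (set_0Vmem B) => [B0|[L LB]]; first by case/and3P: partQ'; rewrite -B0 BQ.
  by rewrite -(pblock_def partQ' BQ LB) -bb (pblockT_mem partQ).
move=> e; apply/eqP/negPn/negP => n.
have inj := split_singletons e n.
have [_ aQ] := (admissibleP Q).1 admQ.
have B1 : (1 < #|b L|)%N.
  apply/card_gt1P; exists L, L'; rewrite (mem_pblockT partQ) e (mem_pblockT partQ); split=> //.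
  by apply: contra n => /eqP ->.
(* The side with four lines supplies the columns [c] of the grid, the other side its three rows
   [r]. *)
have [[h3 [s h4]] _] := aQ _ (pblockT_mem partQ L) B1.
have /card_geqP[rs [urs srs rsP]] := h3 (~~ s).
have /card_geqP[cs [ucs scs csP]] := h4.
pose r (i : 'I_3) := nth L rs i; pose c (j : 'I_4) := nth L cs j.
have rP i : r i \in b L /\ side (r i) = ~~ s.
  by have := rsP _ (mem_nth L (_ : (i < size rs)%N)); rewrite srs inE => /(_ (ltn_ord i))/andP[? /eqP].
have cP i : c i \in b L /\ side (c i) = ~~ ~~ s.
  by have := csP _ (mem_nth L (_ : (i < size cs)%N)); rewrite scs inE negbK => /(_ (ltn_ord i))/andP[? /eqP].
have ri : injective r.
  by move=> i j /eqP; rewrite nth_uniq ?srs // => /eqP/val_inj.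
have ci : injective c.
  by move=> i j /eqP; rewrite nth_uniq ?scs // => /eqP/val_inj.
have sr i := (rP i).2; have sc i := (cP i).2.
have bB M : M \in b L -> b M = b L by apply: pblock_def => //; apply: pblockT_mem.
have [a] := gridpoly_nonzero sr sc ri ci (fun i => bB _ (rP i).1) (fun i => bB _ (cP i).1).
case/eqP; apply: (VG_sub_closed (hk := hk) hl admQ' (zclosed_mxpoly (mxpoly_gridpoly r c))).
  apply: gridpoly_vanish => //; apply/eqP => /inj; rewrite !(rP _).1 => /(_ isT isT) /ri /(congr1 val).
  by [].
by apply: QQ'; apply: (im_VG (hk := hk) admQ); exists a.
Qed.
End Irredundant.

(** * Splitting a block *)

Section Splitting.
Variables k l : nat.
Hypotheses (hk : (3 <= k)%N) (hl : (3 <= l)%N).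
Local Notation line := (line k l).
Local Notation block := {set line}.
Local Notation point := 'I_(k * l).
Local Notation e1 := (e1 hk).
Local Notation e2 := (e2 hk).
Local Notation es := (es hk).
Local Notation meet := (meet hk hl).
Local Notation Phi := (Phi hk).
Local Notation im := (im hk).
Implicit Types (b : line -> block) (x y : point) (L M : line).

(** Labels are the equivalence classes themselves, so [b] behaves as the block map of a
    partition. *)
Definition class_map b := forall L M, (M \in b L) = (b L == b M).

Definition split_block b (B : block) : line -> block := fun L => if L \in B then [set L] else b L.

Section OneBlock.
Variables (b : line -> block) (B : block).
Hypothesis cb : class_map b.
Hypothesis bB : exists L, b L = B.

Lemma class_blockE L : (L \in B) = (b L == B).
Proof. by case: bB => M <-; rewrite cb eq_sym. Qed.

Lemma class_map_split : class_map (split_block b B).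
Proof.
move=> L M; rewrite /split_block; case: ifPn => LB; case: ifPn => MB.
- by rewrite inE (inj_eq set1_inj) eq_sym.
- rewrite inE; apply/eqP/eqP => [e|e]; first by rewrite e LB in MB.
  have : L \in b M by rewrite -e inE.
  by rewrite cb => /eqP e'; move: MB LB; rewrite !class_blockE e' => /negPf ->.
- rewrite cb; apply/eqP/eqP => [e|e].
    by move: LB MB; rewrite !class_blockE e => /negPf ->.
  have : M \in b L by rewrite e inE.
  by rewrite cb => /eqP.
- exact: cb.
Qed.

Lemma split_eq L M : L != M ->
  (split_block b B L == split_block b B M) = (b L == b M) && (L \notin B).
Proof.
move=> LM; rewrite -class_map_split /split_block; case: ifPn => LB; rewrite ?andbF ?andbT.
  by rewrite inE eq_sym (negPf LM).
by rewrite cb.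
Qed.

(* Perturb the covector of [L] in [B] to l + t v_L: the cross product of two such covectors is t (l x (v_M - v_L)) + O(t^2), and the scalars absorb the factor t. *)
Lemma im_split s (a : param k l -> CC) (v : line -> 'cV[CC]_3) :
  (forall x, es s x \in B -> es (~~ s) x \in B -> exists2 mu, mu != 0 &
     cross (covector a (inl B)) (v (es (~~ s) x) - v (es s x)) =
     mu *: cross (covector a (inl B)) (covector a (inr x))) ->
  zclosure (im (split_block b B)) (Phi b a).
Proof.
set ell := covector a (inl B) => Hs.
have /fin_all_exists[mu muP] x : exists mu, e1 x \in B -> e2 x \in B -> mu != 0 /\
    cross ell (v (e2 x) - v (e1 x)) = mu *: cross ell (covector a (inr x)).
  case h1: (e1 x \in B); last by exists 0.
  case h2: (e2 x \in B); last by exists 0.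
  move: Hs; case: s => /= /(_ x); rewrite h1 h2 => /(_ isT isT)[m m0 mE]; first by exists m.
  exists (- m) => _ _; rewrite oppr_eq0 m0; split=> //.
  by rewrite scaleNr -mE -crossNr opprB.
pose G t L := if L \in B then ell + t *: v L else covector a (inl (b L)).
(* The factor [t] of [cross_pencil] is already removed, so the curve extends to [t = 0]; dividing by
   [mu] makes it pass through [Phi b a] there. *)
pose Y t : 'M[CC]_(3, k * l) := \matrix_(i, x) (
  if (e1 x \in B) && (e2 x \in B) then
    (scal a x / mu x) *: (cross ell (v (e2 x) - v (e1 x)) + t *: cross (v (e1 x)) (v (e2 x)))
  else scal a x *: cross (G t (e1 x)) (if b (e1 x) == b (e2 x) then covector a (inr x) else G t (e2 x))) i 0.
have colY t x : col x (Y t) = 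
  if (e1 x \in B) && (e2 x \in B) then
    (scal a x / mu x) *: (cross ell (v (e2 x) - v (e1 x)) + t *: cross (v (e1 x)) (v (e2 x)))
  else scal a x *: cross (G t (e1 x)) (if b (e1 x) == b (e2 x) then covector a (inr x) else G t (e2 x)).
  by apply/colP => i; rewrite !mxE.
have G0 L : G 0 L = covector a (inl (b L)).
  by rewrite /G; case: ifP => //; rewrite class_blockE scale0r addr0 => /eqP ->.
have Y0 : Y 0 = Phi b a.
  apply: eq_from_col => x; rewrite colY col_Phi !G0 /src /tgt scale0r addr0.
  case: ifP => [/andP[h1 h2]|_]; last by case: ifP.
  have [m0 ->] := muP x h1 h2; rewrite (scaler_divK _ _ m0).
  by move: h1 h2; rewrite !class_blockE => /eqP -> /eqP ->; rewrite eqxx.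
rewrite -Y0; apply: zclosed_curve; first exact: zclosure_closed.
  move=> i x; have A := upoly_subalg.
  have PG L : subalg_col upoly (fun t => G t L).
    rewrite /G; case: (L \in B); last exact: subalg_col_cst.
    apply: (subalg_colD A); first exact: subalg_col_cst.
    by apply: (subalg_colZ A); [exact: upoly_id|exact: subalg_col_cst].
  have : subalg_col upoly (fun t => col x (Y t)).
    rewrite (functional_extensionality _ _ (colY^~ x)).
    case: (_ && _); apply: (subalg_colZ A); try exact: (subalg_const A).
      apply: (subalg_colD A); first exact: subalg_col_cst.
      by apply: (subalg_colZ A); [exact: upoly_id|exact: subalg_col_cst].
    apply: (subalg_cross A) => //; case: (_ == _) => //; exact: subalg_col_cst.
  by move/(subalg_coord i); apply: (subalg_ext A) => t; rewrite mxE.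
move=> t t0; apply: sub_zclosure.
pose f (w : vertex k l) := match w with
  | inl D => if [pick L in B | D == [set L]] is Some L then G t L else covector a w
  | inr x => covector a w end.
pose c x := if (e1 x \in B) && (e2 x \in B) then scal a x / mu x / t else scal a x.
exists (mkparam f c).
have fG L : f (inl (split_block b B L)) = G t L.
  rewrite /f /split_block; case: pickP => [M /andP[MB]|]; case: ifPn => LB.
  - by rewrite (inj_eq set1_inj) => /eqP ->.
  - move=> /eqP e; have : M \in b L by rewrite e inE.
    by rewrite cb => /eqP h; move: LB MB; rewrite !class_blockE h => /negPf ->.
  - by move/(_ L); rewrite LB eqxx.
  - by rewrite /G (negPf LB).
apply: eq_from_col => x; rewrite colY col_Phi !covector_mk /src /tgt split_eq //.
rewrite (_ : scal (mkparam f c) x = c x) // /c; case: ifPn => [/andP[h1 h2]|h].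
  rewrite h1 andbF !fG /G h1 h2.
  by rewrite cross_pencil (scaler_divK _ _ t0).
rewrite fG; case: (eqVneq (b (e1 x)) (b (e2 x))) => [e|_]; last by rewrite fG.
have e12 : (e2 x \in B) = (e1 x \in B) by rewrite !class_blockE e.
by move: h; rewrite e12 andbb => /negPf ->.
Qed.

(** * Blocks with at most two lines on one side *)

Section TwoLines.
Variables (s : bool) (r1 r2 : line).
Hypotheses (s1 : side r1 = s) (s2 : side r2 = s) (r12 : r1 != r2).
Hypothesis Br : forall L, L \in B -> side L = s -> L = r1 \/ L = r2.

(** Putting [r1] at [0] and [r2] at a fixed [z] leaves two conditions on each crossing line, solved
    independently by [colvec]. *)
Lemma im_split_two a : zclosure (im (split_block b B)) (Phi b a).
Proof.
pose z : 'cV[CC]_3 := vec3 1 1 0.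
pose ell a := covector a (inl B); pose w r L a := covector a (inr (meet r L)).
(* The factors make [colvec] defined and the multipliers [mu] on both lines nonzero. *)
pose g a := \prod_(L | side L == ~~ s) (det3 (ell a) (w r1 L a) (w r2 L a) *
  det3 (ell a) z (w r2 L a) * det3 (ell a) z (w r1 L a)).
pose a0 : param k l -> CC := mkparam (fun v => match v with inl _ => vec3 0 0 1
  | inr x => if es s x == r1 then vec3 1 0 0 else vec3 0 1 0 end) (fun=> 0).
have A := polyfun_subalg (param k l).
apply: (@zclosed_dense _ _ _ _ (@polyfun_Phi _ _ hk b) _ g a0); first exact: zclosure_closed.
- apply: (subalg_prod A) => L.
  by do 2?[apply: (subalg_mul A)]; apply: (subalg_det3 A);
    try exact: polyfun_covector; apply: subalg_col_cst.
- apply/prodf_neq0 => L /eqP sL.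
  have [h1 _] := es_meet hk hl s1 sL; have [h2 _] := es_meet hk hl s2 sL.
  rewrite /ell /w !covector_mk h1 h2 eqxx [r2 == r1]eq_sym (negPf r12).
  have -> : det3 (vec3 0 0 1) (vec3 1 0 0) (vec3 0 1 0) = 1 :> CC.
    by rewrite /det3 /dot /cross !coordE; ring.
  have -> : det3 (vec3 0 0 1) z (vec3 0 1 0) = 1 by rewrite /det3 /dot /cross !coordE; ring.
  have -> : det3 (vec3 0 0 1) z (vec3 1 0 0) = -1 by rewrite /det3 /dot /cross !coordE; ring.
  by rewrite !mul1r oppr_eq0 oner_eq0.
move=> {a} a /prodf_neq0 ga.
pose v L := if side L == s then (if L == r1 then 0 else z)
  else colvec (ell a) ((w r1)^~ a) ((w r2)^~ a) z L.
apply: (im_split (s := s) (v := v)) => x rB cB.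
have := meet_es hk hl s x; set c := es (~~ s) x; set r := es s x => xE.
have sc : side c = ~~ s by apply: side_es.
have := ga c; rewrite sc eqxx => /(_ isT)/mul_neq0[/mul_neq0[D0 z2] z1].
have -> : v c = colvec (ell a) ((w r1)^~ a) ((w r2)^~ a) z c.
  by rewrite /v sc; case: (s).
have sr : side r = s by apply: side_es.
have [er|er] := Br rB sr; rewrite /v sr eqxx.
- have xr : meet r1 c = x by rewrite -er xE.
  rewrite /r er eqxx subr0; exists (det3 (ell a) z (w r2 c a) / det3 (ell a) (w r1 c a) (w r2 c a)).
    exact: (div_neq0 z2 D0).
  have wx : w r1 c a = covector a (inr x) by rewrite /w xr.
  by rewrite -wx; exact: crossZr.
- have xr : meet r2 c = x by rewrite -er xE.
  rewrite /r er [r2 == r1]eq_sym (negPf r12); exists (det3 (ell a) z (w r1 c a) / det3 (ell a) (w r1 c a) (w r2 c a)).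
    exact: (div_neq0 z1 D0).
  have wx : w r2 c a = covector a (inr x) by rewrite /w xr.
  by rewrite -wx; exact: (cross_colvec_row2 (w1 := (w r1)^~ a) (w2 := (w r2)^~ a) z D0).
Qed.
End TwoLines.

(** * Blocks with at most three lines on each side *)

Section ThreeByThree.
Variables (s : bool) (r c : 'I_3 -> line).
Hypotheses (sr : forall i, side (r i) = s) (sc : forall i, side (c i) = ~~ s).
Hypotheses (ri : injective r) (ci : injective c).
Hypothesis Br : forall L, L \in B -> side L = s -> exists i, L = r i.
Hypothesis Bc : forall L, L \in B -> side L = ~~ s -> exists i, L = c i.

Lemma ord3P (i : 'I_3) : [\/ i = @Ordinal 3 0 isT, i = @Ordinal 3 1 isT | i = @Ordinal 3 2 isT].
Proof.
by case: i => -[|[|[|i]]] hi //; [apply: Or31|apply: Or32|apply: Or33]; apply: val_inj.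
Qed.

(** With a third row [z] is no longer free, but three columns impose a single linear condition on
    it, solved by [zvec]; the third row is [row3vec]. *)
Lemma im_split_three a : zclosure (im (split_block b B)) (Phi b a).
Proof.
pose i0 := @Ordinal 3 0 isT; pose i1 := @Ordinal 3 1 isT; pose i2 := @Ordinal 3 2 isT.
pose ell a := covector a (inl B); pose w i j a := covector a (inr (meet (r i) (c j))).
pose z a := zvec (ell a) ((w i0)^~ a) ((w i1)^~ a) ((w i2)^~ a) i0 i1 i2.
pose D j a := det3 (ell a) (w i0 j a) (w i1 j a).
(* The difference of columns [p] and [q] paired with [u], with the denominators of [det3_colvec]
   cleared. *)
pose E p q u a := det3 (ell a) (z a) (w i1 p a) * D q a * det3 (ell a) (w i0 p a) u
  - det3 (ell a) (z a) (w i1 q a) * D p a * det3 (ell a) (w i0 q a) u.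
pose g a := \prod_j (D j a * det3 (ell a) (z a) (w i0 j a) * det3 (ell a) (z a) (w i1 j a)) *
  (det3 (ell a) (w i2 i0 a) (w i2 i1 a) * det3 (ell a) (w i2 i0 a) (w i2 i2 a) *
  (E i1 i0 (w i2 i1 a) a * E i1 i0 (w i2 i0 a) a * E i2 i0 (w i2 i0 a) a)).
pose p : 'cV[CC]_3 := vec3 1 0 0; pose q : 'cV[CC]_3 := vec3 0 1 0.
pose m : 'cV[CC]_3 := vec3 1 1 0.
(* The directions form the table with rows [m p q], [p q p], [q m m], at which no factor of [g]
   vanishes. *)
pose num (i j : bool * bool) : 'cV[CC]_3 :=
  match i, j with
  | (true, _), (true, _) => m | (true, _), (_, true) => p | (true, _), _ => q
  | (_, true), (_, true) => q | (_, true), _ => p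
  | _, (true, _) => q | _, _ => m
  end.
pose a0 : param k l -> CC := mkparam (fun v => match v with inl _ => vec3 0 0 1
  | inr x => num (es s x == r i0, es s x == r i1) (es (~~ s) x == c i0, es (~~ s) x == c i1) end)
  (fun=> 0).
have A := polyfun_subalg (param k l).
apply: (@zclosed_dense _ _ _ _ (@polyfun_Phi _ _ hk b) _ g a0); first exact: zclosure_closed.
- have Pl : subalg_col (@polyfun (param k l)) ell by apply: polyfun_covector.
  have Pw i j : subalg_col (@polyfun (param k l)) (w i j) by apply: polyfun_covector.
  have Pz : subalg_col (@polyfun (param k l)) z by exact: (subalg_zvec A i0 i1 i2 Pl (Pw i0) (Pw i1) (Pw i2)).
  have PD j : polyfun (D j) by apply: (subalg_det3 A).
  have PE j1 j2 u : subalg_col (@polyfun (param k l)) u -> polyfun (fun a => E j1 j2 (u a) a).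
    by move=> Pu; apply: (subalg_sub A); do 2?[apply: (subalg_mul A) => //]; apply: (subalg_det3 A).
  apply: (subalg_mul A).
    by apply: (subalg_prod A) => j; do 2?[apply: (subalg_mul A) => //]; apply: (subalg_det3 A).
  apply: (subalg_mul A); first by apply: (subalg_mul A); apply: (subalg_det3 A).
  by do 2?[apply: (subalg_mul A) => //]; apply: PE.
- have W i j : w i j a0 = num (i == i0, i == i1) (j == i0, j == i1).
    have [h1 h2] := es_meet hk hl (sr i) (sc j).
    by rewrite /w covector_mk h1 h2 !(inj_eq ri) !(inj_eq ci).
  have br (x1 y1 x2 y2 : CC) : det3 (vec3 0 0 1) (vec3 x1 y1 0) (vec3 x2 y2 0) = x1 * y2 - y1 * x2.
    by rewrite /det3 /dot /cross !coordE; ring.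
  have lE : ell a0 = vec3 0 0 1 by rewrite /ell covector_mk.
  have zE : z a0 = vec3 (-1) 1 0.
    rewrite /z /zvec /kappa lE !W /num /= /p /q /m !br.
    by apply: col3P; rewrite !coordE; ring.
  have n1 : (-1 : CC) != 0 by rewrite oppr_eq0 oner_eq0.
  have n2 : (2 : CC) != 0 by rewrite Num.Theory.pnatr_eq0.
  have D0 j : det3 (ell a0) (w i0 j a0) (w i1 j a0) * det3 (ell a0) (z a0) (w i0 j a0) *
      det3 (ell a0) (z a0) (w i1 j a0) != 0.
    rewrite zE lE !W; have [->|->|->] := ord3P j; rewrite /num /= /p /q /m !br.
    - by rewrite (_ : _ * _ = -2) ?oppr_eq0 //; ring.
    - by rewrite (_ : _ * _ = 1) ?oner_eq0 //; ring.
    - by rewrite (_ : _ * _ = -1) //; ring.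
  have E1 : E i1 i0 (w i2 i1 a0) a0 = 1.
    by rewrite /E /D zE lE !W /num /= /p /q /m !br; ring.
  have E2 : E i1 i0 (w i2 i0 a0) a0 = 2.
    by rewrite /E /D zE lE !W /num /= /p /q /m !br; ring.
  have E3 : E i2 i0 (w i2 i0 a0) a0 = -1.
    by rewrite /E /D zE lE !W /num /= /p /q /m !br; ring.
  have E4 : det3 (ell a0) (w i2 i0 a0) (w i2 i1 a0) = -1.
    by rewrite lE !W /num /= /p /q /m br; ring.
  have E5 : det3 (ell a0) (w i2 i0 a0) (w i2 i2 a0) = -1.
    by rewrite lE !W /num /= /p /q /m br; ring.
  rewrite /g E1 E2 E3 E4 E5 mulf_neq0 //; first by apply/prodf_neq0 => j _; apply: D0.
  by rewrite mulrNN !mul1r mulrN1 oppr_eq0.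
move=> {a} a /mul_neq0[/prodf_neq0 g1].
move=> /mul_neq0[/mul_neq0[g2 g3] /mul_neq0[/mul_neq0[g4 g5] g6]].
have DN j : D j a != 0 := (mul_neq0 (mul_neq0 (g1 j isT)).1).1.
have z0N j : det3 (ell a) (z a) (w i0 j a) != 0 := (mul_neq0 (mul_neq0 (g1 j isT)).1).2.
have z1N j : det3 (ell a) (z a) (w i1 j a) != 0 := (mul_neq0 (g1 j isT)).2.
pose cv j := colvec (ell a) ((w i0)^~ a) ((w i1)^~ a) (z a) j.
pose r3 := row3vec (ell a) ((w i0)^~ a) ((w i1)^~ a) ((w i2)^~ a) i0 i1 i2.
have EN j1 j2 u : E j1 j2 u a != 0 -> det3 (ell a) (cv j1 - cv j2) u != 0.
  have <- : D j1 a * D j2 a * det3 (ell a) (cv j1 - cv j2) u = E j1 j2 u a.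
    exact: (det3_colvec (w1 := (w i0)^~ a) (w2 := (w i1)^~ a) (z a) u (DN j1) (DN j2)).
  by case/mul_neq0.
have [k0 k1 k2] := colvec_row3 (w1 := (w i0)^~ a) (w2 := (w i1)^~ a) (w3 := (w i2)^~ a) (DN i0) (DN i1) (DN i2) g2.
have [n0 n1 n2] := row3vec_neq (w1 := (w i0)^~ a) (w2 := (w i1)^~ a) (w3 := (w i2)^~ a) (DN i0) (DN i1) (DN i2) g2.
have X j : exists2 mu, mu != 0 & cross (ell a) (cv j - r3) = mu *: cross (ell a) (w i2 j a).
  have g2' := det3C_neq0 g2; have g3' := det3C_neq0 g3.
  have g4' : det3 (ell a) (cv i0 - cv i1) (w i2 i1 a) != 0.
    have := EN _ _ _ g4; rewrite -(opprB (cv i0)) -scaleN1r det3Zl => h.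
    exact: (mul_neq0 h).2.
  have [->|->|->] := ord3P j.
  - by apply: (cross_par_neq0 k0 g2); rewrite n0; exact: g4'.
  - by apply: (cross_par_neq0 k1 g2'); rewrite n1; exact: (EN _ _ _ g5).
  - by apply: (cross_par_neq0 k2 g3'); rewrite n2; exact: (EN _ _ _ g6).
pose v L := if side L == s then (if L == r i0 then 0 else if L == r i1 then z a else r3)
  else if [pick j | L == c j] is Some j then cv j else 0.
apply: (im_split (s := s) (v := v)) => x rB cB.
have sx : side (es s x) = s by apply: side_es.
have sx' : side (es (~~ s) x) = ~~ s by apply: side_es.
have [i iE] := Br rB sx; have [j jE] := Bc cB sx'.
have xE : w i j a = covector a (inr x) by rewrite /w -iE -jE meet_es.
have vc : v (c j) = cv j.
  rewrite /v sc (_ : (~~ s == s) = false); last by case: (s).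
  by case: pickP => [h /eqP/ci -> //|/(_ j)]; rewrite eqxx.
rewrite -xE iE jE vc /v sr eqxx !(inj_eq ri); have [->|->|->] := ord3P i.
- rewrite subr0 crossZr; exists (det3 (ell a) (z a) (w i1 j a) / D j a); last by [].
  exact: (div_neq0 (z1N j) (DN j)).
- exists (det3 (ell a) (z a) (w i0 j a) / D j a); first exact: (div_neq0 (z0N j) (DN j)).
  exact: (cross_colvec_row2 (w1 := (w i0)^~ a) (w2 := (w i1)^~ a) (z a) (DN j)).
- exact: X.
Qed.
End ThreeByThree.
End OneBlock.
End Splitting.

(** * Decomposition *)

(** Supplies two distinct lines on a side even when the block has fewer there. *)
Lemma subset_pair (T : finType) (A S : {set T}) : A \subset S -> (#|A| <= 2)%N -> (2 <= #|S|)%N ->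
  exists x y, [/\ x \in S, y \in S, x != y & A \subset [set x; y]].
Proof.
move=> AS A2 S2; case: (ltnP 1 #|A|) => A1.
  have /cards2P[x [y [xy e]]] : #|A| == 2 by rewrite eqn_leq A2 A1.
  by exists x, y; split=> //; try apply: (subsetP AS); rewrite e ?inE ?eqxx ?orbT.
have [x [y [xS yS xy]]] := card_gt1P S2.
case: (set_0Vmem A) => [->|[t tA]]; first by exists x, y; rewrite sub0set.
have e : A \subset [set t].
  by apply/subsetP => u uA; rewrite inE; apply/eqP; apply: (card_le1_eqP A1).
have tS := subsetP AS t tA.
have [u uS tu] : exists2 u, u \in S & t != u.
  by case: (eqVneq t x) => [->|tx]; [exists y|exists x].
exists t, u; split=> //; apply: subset_trans e _; by rewrite sub1set !inE eqxx.
Qed.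

Section Decomposition.
Variables k l : nat.
Hypotheses (hk : (3 <= k)%N) (hl : (3 <= l)%N).
Local Notation line := (line k l).
Local Notation block := {set line}.
Local Notation point := 'I_(k * l).
Local Notation e1 := (e1 hk).
Local Notation e2 := (e2 hk).
Local Notation es := (es hk).
Local Notation meet := (meet hk hl).
Local Notation Phi := (Phi hk).
Local Notation im := (im hk).
Implicit Types (b : line -> block) (x y : point) (L M : line).

Definition classes b : {set block} := [set b L | L : line].

Lemma partition_classes b : class_map b -> partition (classes b) [set: line] /\ pblock (classes b) =1 b.
Proof.
move=> cb; have bb L : L \in b L by rewrite cb.
have tr : trivIset (classes b).
  apply/trivIsetP => _ _ /imsetP[L _ ->] /imsetP[M _ ->] n.
  rewrite -setI_eq0; apply: contraNT n => /set0Pn[N]; rewrite inE !cb => /andP[/eqP -> /eqP ->].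
  by [].
have p : partition (classes b) [set: line].
  apply/and3P; split=> //.
    rewrite eqEsubset subsetT; apply/subsetP => L _; apply/bigcupP; exists (b L) => //.
    exact: imset_f.
  by apply/imsetP => -[L _ e]; have := bb L; rewrite -e inE.
by split=> // L; apply: def_pblock => //; apply: imset_f.
Qed.

Lemma not_rich_split b B : class_map b -> (exists L, b L = B) -> ~ rich B ->
  forall a, zclosure (im (split_block b B)) (Phi b a).
Proof.
move=> cb bB nr.
case: (classic (exists s, #|[set L in B | side L == s]| <= 2)%N) => [[s As]|H].
  have AS : [set L in B | side L == s] \subset [set L : line | side L == s].
    by apply/subsetP => L; rewrite !inE => /andP[].
  have [r1 [r2 []]] := subset_pair AS As (ltnW (card_side hk hl s)).
  rewrite !inE => /eqP s1 /eqP s2 r12 /subsetP Ar.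
  apply: (im_split_two hl cb bB s1 s2 r12) => L LB sL.
  by have := Ar L; rewrite !inE LB sL eqxx => /(_ isT)/orP[]/eqP ->; [left|right].
(* No side has fewer than three lines, and a side with four would make the block rich. *)
have c3 s : #|[set L in B | side L == s]| = 3%N.
  have ge : (3 <= #|[set L in B | side L == s]|)%N.
    by rewrite ltnNge; apply/negP => h; apply: H; exists s.
  apply/eqP; rewrite eqn_leq ge andbT leqNgt; apply/negP => h; apply: nr; split; last by exists s.
  by move=> t; rewrite ltnNge; apply/negP => h'; apply: H; exists t.
have enum_side s : exists r : 'I_3 -> line, [/\ forall i, side (r i) = s, injective r &
    forall L, L \in B -> side L = s -> exists i, L = r i].
  have /card_gt0P[L0 _] : (0 < #|[set L in B | side L == s]|)%N by rewrite c3.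
  set E := [set L in B | side L == s]; have sE : size (enum E) = 3%N by rewrite -cardE /E c3.
  exists (fun i => nth L0 (enum E) i); split=> [i|i j /eqP|L LB sL].
  - have : nth L0 (enum E) i \in E by rewrite -mem_enum mem_nth // sE.
    by rewrite inE => /andP[_ /eqP].
  - by rewrite nth_uniq ?enum_uniq ?sE // => /eqP/val_inj.
  - have LE : L \in enum E by rewrite mem_enum inE LB sL eqxx.
    have i3 : (index L (enum E) < 3)%N by rewrite -sE index_mem.
    by exists (Ordinal i3); rewrite /= nth_index.
have [r [sr ri rB]] := enum_side true; have [c [sc ci cB]] := enum_side false.
exact: (im_split_three hl cb bB (s := true) sr sc ri ci rB cB).
Qed.

Lemma admissible_setT : rich [set: line] -> admissible [set [set: line]].
Proof.
move=> rT; apply/admissibleP; split.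
  rewrite /partition cover1 eqxx /= trivIset1 /= inE eq_sym -card_gt0 cardsT.
  by apply/card_gt0P; exists (inl (Ordinal (leq_trans (isT : 0 < 3)%N hk))).
by move=> B; rewrite inE => /eqP -> _; split=> //; rewrite cards1.
Qed.

(* If all rows, or all columns, share one covector, then every point lies on the corresponding line. *)
Lemma im_not_partial b B s Y : (forall L, side L = s -> b L = B) -> im b Y ->
  im (fun=> [set: line]) Y.
Proof.
move=> H [a ->].
have /fin_all_exists[w wE] x : exists w : 'cV[CC]_3,
    cross (covector a (src hk b x)) (covector a (tgt hk b x)) = cross (covector a (inl B)) w.
  rewrite /src /tgt; have := H (es s x) (side_es hk s x); case: s {H} => /= ->; first by eexists.
  case: eqP => [->|_]; first by eexists.
  by rewrite crossC -crossNr; eexists.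
exists (mkparam (fun v => match v with inl _ => covector a (inl B) | inr x => w x end) (scal a)).
apply: eq_from_col => x; rewrite [LHS]col_Phi [RHS]col_Phi wE.
by congr (_ *: cross _ _); rewrite ?covector_mk // /tgt eqxx.
Qed.

Lemma im_pblock b Q : class_map b -> Q = classes b -> im (pblock Q) = im b.
Proof.
move=> cb ->; have [_ e] := partition_classes cb.
by rewrite (functional_extensionality _ _ e).
Qed.

(** Induction on the number of lines in non-singleton blocks: splitting a block that is not rich
    lowers it. If all such blocks are rich and one contains a full side, the trivial partition takes
    over. *)
Lemma class_map_admissible b : class_map b ->
  exists2 Q, admissible Q & forall Y, im b Y -> VG Q Y.
Proof.
have [n] := ubnP #|[set L | b L != [set L]]|; elim: n b => // n IH b bn cb.
have bb L : L \in b L by rewrite cb.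
case: (classic (forall L, (1 < #|b L|)%N -> rich (b L))) => [R|]; last first.
  move=> H; have [L0 H0] := not_all_ex_not _ _ H; have [B1 nr] := imply_to_and _ _ H0.
  have bB : exists L, b L = b L0 by exists L0.
  have [||Q aQ QV] := IH (split_block b (b L0)); last first; try exact: class_map_split.
    exists Q; first exact: aQ.
    move=> _ [a ->].
    by apply: zclosure_min (not_rich_split cb bB nr a); first exact: zclosure_closed.
  rewrite ltnS in bn; apply: leq_trans bn; apply: proper_card.
  apply/properP; split.
    apply/subsetP => L; rewrite !inE /split_block; case: ifP => //; by rewrite eqxx.
  exists L0; rewrite !inE /split_block ?bb ?eqxx //.
  by apply: contraTneq B1 => ->; rewrite cards1.
have [pb be] := partition_classes cb.
case: (classic (forall L, (1 < #|b L|)%N -> (1 < #|classes b|)%N -> partial (b L))) => [P|].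
  exists (classes b); last first.
    by move=> Y; rewrite -(im_pblock cb erefl); apply: im_VG; apply/admissibleP; split=> // _ /imsetP[L _ ->] L1; split; [exact: R|exact: P].
  by apply/admissibleP; split=> // _ /imsetP[L _ ->] L1; split; [exact: R|exact: P].
move=> H; have [L0 H0] := not_all_ex_not _ _ H; have [B1 H1] := imply_to_and _ _ H0.
have [_ nP] := imply_to_and _ _ H1.
have [s sB] : exists s, forall L, side L = s -> b L = b L0.
  apply: NNPP => nS; apply: nP => s; apply: NNPP => nL; apply: nS; exists s => L sL.
  apply/eqP; rewrite eq_sym -cb; apply/negPn/negP => LB; apply: nL; by exists L.
have rT : rich [set: line].
  have [r1 [t r2]] := R L0 B1; have sub u : (#|[set L in b L0 | side L == u]| <=
      #|[set L in [set: line] | side L == u]|)%N.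
    by apply/subset_leq_card/subsetP => L; rewrite !inE => /andP[_ ->].
  by split=> [u|]; [exact: leq_trans (r1 u) (sub u)|exists t; exact: leq_trans r2 (sub t)].
have aT := admissible_setT rT; exists [set [set: line]] => // Y /(im_not_partial sB) YT.
apply: (im_VG (hk := hk) aT); move: YT.
suff -> : (fun=> [set: line]) = pblock [set [set: line]] by [].
apply: functional_extensionality => L; apply/esym/def_pblock; rewrite ?inE //.
exact: trivIset1.
Qed.

(** Each line has a nonzero covector killing its points; labels are the classes of proportional
    covectors. *)
Lemma VDelta_im Y : VDelta k l Y -> exists2 b, class_map b & im b Y.
Proof.
move=> VY.
have /fin_all_exists[f fP] L : exists f : 'cV[CC]_3, f != 0 /\
    forall x, x \in line_set L -> dot f (col x Y) = 0.
  have [T TL T3|f f0 fP] := @common_orth_dependent _ Y (line_set L); last by exists f.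
  by apply/cols_dependent_rank; apply: VY => //; exists L.
have f0 L := (fP L).1; have fY L := (fP L).2.
pose b L := [set M | cross (f L) (f M) == 0].
have bb L : L \in b L by rewrite inE crossuu.
have sym L M : cross (f L) (f M) = 0 -> cross (f M) (f L) = 0.
  by move=> h; rewrite crossC h oppr0.
have cb : class_map b.
  move=> L M; apply/idP/eqP => [|->]; last exact: bb.
  rewrite in_set => /eqP h; apply/setP => N; rewrite 2!in_set.
  apply/eqP/eqP => h'; last exact: cross_trans (f0 M) h h'.
  by apply: cross_trans (f0 L) (sym _ _ h) h'.
exists b => //.
(* One covector represents each label; the default value serves only the empty set. *)
pose g (D : block) := if [pick L in D] is Some L then f L else vec3 0 0 1.
have gP L : exists2 M, g (b L) = f M & cross (f L) (f M) = 0.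
  rewrite /g; case: pickP => [M|/(_ L)]; last by rewrite bb.
  by rewrite inE => /eqP; exists M.
apply: (im_of_orth (f := g)) => [x|s x|x n].
- by have [M -> _] := gP (e1 x).
- have [M -> h] := gP (es s x); have [c ->] := cross_eq0 (f0 (es s x)) (sym _ _ h).
  by rewrite dotZl fY ?mulr0 // (in_line_set hk) side_es.
- have [M gM h] := gP (e1 x); have [N gN h'] := gP (e2 x); rewrite gM gN.
  apply: contra n => /eqP e; rewrite -cb inE; apply/eqP.
  by apply: cross_trans (f0 M) h _; apply: cross_trans (f0 N) e _; apply: sym.
Qed.
End Decomposition.

Theorem theorem5p8 (k l : nat) (hk : (3 <= k)%N) (hl : (3 <= l)%N) :
  (* decomposition *)
  (forall Y, VDelta k l Y <-> exists Q : {set {set line k l}}, admissible Q /\ VG Q Y) /\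
  (* each component irreducible *)
  (forall Q : {set {set line k l}}, admissible Q -> zirreducible (VG Q)) /\
  (* irredundant *)
  (forall Q Q' : {set {set line k l}}, admissible Q -> admissible Q' -> Q != Q' ->
     ~ (forall Y, VG Q Y -> VG Q' Y)).
Proof.
split=> [Y|]; last split=> [Q aQ|Q Q' aQ aQ' n H].
- split=> [/(VDelta_im hk)[b cb bY]|[Q [aQ QY]]]; last exact: VG_VDelta QY.
  by have [Q aQ QV] := class_map_admissible hk hl cb; exists Q; split=> //; apply: QV.
- exact: VG_irreducible.
- by move: n; rewrite (VG_sub_eq hk hl aQ aQ' H) eqxx.
Qed.
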